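(* Let $\alpha\le 2$ and suppose that $f\in D_{\alpha-1}$ satisfies condition NZAC on the unit disk. Then the function $E_1(f)(z_1,z_2)=f(z_1)$ is cyclic in $\mathcal{D}_\alpha$, and, for those $\alpha$ for which $\varphi_{\alpha-1}$ is defined (that is, $1\le\alpha\le 2$), $$\mathrm{dist}^2_{\mathcal{D}_\alpha}\bigl(1,E_1(f)\cdot\mathcal{P}_n\bigr)\asymp \frac{1}{\varphi_{\alpha-1}(n+1)}\qquad (n\to\infty).$$
   Context: Let $\mathbb{B}^2=\{(z_1,z_2)\in\mathbb{C}^2: |z_1|^2+|z_2|^2<1\}$ and $\mathbb{D}=\{z\in\mathbb{C}:|z|<1\}$, with $\mathbb{T}=\partial\mathbb{D}$. For $\alpha\in\mathbb{R}$, the Dirichlet-type space $\mathcal{D}_\alpha$ consists of the analytic functions $F(z_1,z_2)=\sum_{k,l\ge 0}a_{k,l}z_1^kz_2^l$ on $\mathbb{B}^2$ with $$\|F\|_\alpha^2=\sum_{k=0}^\infty\sum_{l=0}^\infty(2+k+l)^\alpha\frac{k!\,l!}{(1+k+l)!}|a_{k,l}|^2<\infty.$$ For $\beta\in\mathbb{R}$, the one-variable space $D_\beta$ consists of the analytic functions $f(z)=\sum_{k\ge0}a_kz^k$ on $\mathbb{D}$ with $\|f\|_{D_\beta}^2=\sum_{k\ge 0}(k+1)^\beta|a_k|^2<\infty$. For a one-variable function $f$ on $\mathbb{D}$, $E_1(f)(z_1,z_2)=f(z_1)$ for $(z_1,z_2)\in\mathbb{B}^2$. A function $F\in\mathcal{D}_\alpha$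 is cyclic in $\mathcal{D}_\alpha$ if the closed linear span in $\mathcal{D}_\alpha$ of $\{z_1^kz_2^lF: k,l=0,1,2,\dots\}$ is all of $\mathcal{D}_\alpha$. Condition NZAC (on the unit disk): $f$ has no zeros in $\mathbb{D}$, $f$ admits an analytic continuation to a strictly bigger disk (concentric with $\mathbb{D}$), and $f$ has at least one zero on $\mathbb{T}$. $\mathcal{P}_n$ denotes the space of polynomials in two complex variables of degree at most $2n$, and $\mathrm{dist}_{\mathcal{D}_\alpha}(1,F\cdot\mathcal{P}_n)=\inf_{p\in\mathcal{P}_n}\|p\cdot F-1\|_\alpha$. For $\beta\in[0,1)$ set $\varphi_\beta(n)=n^{1-\beta}$ ($n=1,2,\dots$), and set $\varphi_1(n)=\sum_{j=1}^n j^{-1}$. The notation $A_n\asymp B_n$ means that the two quantities are bounded by constant multiples of each other, with positive constants independent of $n$ (they may depend on $f$ and $\alpha$). *)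

(* Defs.v *)
From mathcomp Require Import all_boot all_order all_algebra.
From mathcomp Require Import all_classical all_reals all_analysis.
From mathcomp.real_closed Require Export complex.

Set Implicit Arguments.
Unset Strict Implicit.
Unset Printing Implicit Defensive.

Import Order.TTheory GRing.Theory Num.Theory.
Import ComplexField.Normc.
Import numFieldNormedType.Exports.

Local Open Scope classical_set_scope.
Local Open Scope ring_scope.
Local Open Scope complex_scope.

Definition disk (R : realType) (r : R) : set R[i] := [set z | normc z < r].

Definition unit_circle (R : realType) : set R[i] := [set z | normc z = 1].

Definition unit_ball2 (R : realType) : set (R[i] * R[i]) :=
  [set z | normc z.1 ^+ 2 + normc z.2 ^+ 2 < 1].

(* Functions on a disk or on the ball are total functions of which only the
   values on that disk or ball are ever used. *)
Definition taylor_on_disk (R : realType) (r : R) (a : nat -> R[i])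
    (f : R[i] -> R[i]) : Prop :=
  forall z, disk r z ->
    (fun N : nat => \sum_(k < N) a k * z ^+ k) @ \oo --> (f z : R[i]^o).

Definition analytic_on_disk (R : realType) (r : R) (f : R[i] -> R[i]) : Prop :=
  exists a, taylor_on_disk r a f.

(* The double series is required to converge absolutely, so that its sum does
   not depend on the order of summation; square partial sums are one choice. *)
Definition taylor_on_ball (R : realType) (a : nat -> nat -> R[i])
    (F : R[i] * R[i] -> R[i]) : Prop :=
  forall z, unit_ball2 z ->
    (\sum_(0 <= k <oo) \sum_(0 <= l <oo)
       (normc (a k l * z.1 ^+ k * z.2 ^+ l))%:E < +oo)%E /\
    (fun N : nat => \sum_(k < N) \sum_(l < N) a k l * z.1 ^+ k * z.2 ^+ l)
      @ \oo --> (F z : R[i]^o).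

Definition analytic_on_ball (R : realType) (F : R[i] * R[i] -> R[i]) : Prop :=
  exists a, taylor_on_ball a F.

(* The Taylor coefficients at the origin: they are unique for an analytic
   function, and 0 by convention for any other function. *)
Definition disk_coef (R : realType) (f : R[i] -> R[i]) : nat -> R[i] :=
  xget (fun=> 0) [set a | taylor_on_disk 1 a f].

Definition ball_coef (R : realType) (F : R[i] * R[i] -> R[i]) : nat -> nat -> R[i] :=
  xget (fun=> fun=> 0) [set a | taylor_on_ball a F].

Definition sqnorm1 (R : realType) (beta : R) (f : R[i] -> R[i]) : \bar R :=
  (\sum_(0 <= k <oo) (k.+1%:R `^ beta * normc (disk_coef f k) ^+ 2)%:E)%E.

Definition dirichlet1 (R : realType) (beta : R) : set (R[i] -> R[i]) :=
  [set f | analytic_on_disk 1 f /\ (sqnorm1 beta f < +oo)%E].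

Definition sqnorm2 (R : realType) (alpha : R) (F : R[i] * R[i] -> R[i]) : \bar R :=
  (\sum_(0 <= k <oo) \sum_(0 <= l <oo)
     ((2 + k + l)%:R `^ alpha * ((k`! * l`!)%:R / ((1 + k + l)`!)%:R)
        * normc (ball_coef F k l) ^+ 2)%:E)%E.

Definition dnorm (R : realType) (alpha : R) (F : R[i] * R[i] -> R[i]) : \bar R :=
  sqrte (sqnorm2 alpha F).

Definition dirichlet2 (R : realType) (alpha : R) : set (R[i] * R[i] -> R[i]) :=
  [set F | analytic_on_ball F /\ (sqnorm2 alpha F < +oo)%E].

Definition lin_span (R : realType) (S : set (R[i] * R[i] -> R[i])) :
    set (R[i] * R[i] -> R[i]) :=
  [set G | exists (m : nat) (c : 'I_m -> R[i]) (s : 'I_m -> R[i] * R[i] -> R[i]),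
     (forall i, S (s i)) /\ G = (fun z => \sum_(i < m) c i * s i z)].

Definition dclosure (R : realType) (alpha : R) (S : set (R[i] * R[i] -> R[i])) :
    set (R[i] * R[i] -> R[i]) :=
  [set G | dirichlet2 alpha G /\
     forall e : R, 0 < e ->
       exists2 H, S H & (dnorm alpha (fun z => (G z - H z)%R) < e%:E)%E].

Definition monomial_multiples (R : realType) (F : R[i] * R[i] -> R[i]) :
    set (R[i] * R[i] -> R[i]) :=
  [set G | exists k l : nat, G = (fun z => z.1 ^+ k * z.2 ^+ l * F z)].

Definition cyclic (R : realType) (alpha : R) (F : R[i] * R[i] -> R[i]) : Prop :=
  dirichlet2 alpha F /\
  dclosure alpha (lin_span (monomial_multiples F)) = dirichlet2 alpha.

Definition E1 (R : realType) (f : R[i] -> R[i]) : R[i] * R[i] -> R[i] :=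
  fun z => f z.1.

Definition NZAC (R : realType) (f : R[i] -> R[i]) : Prop :=
  (forall z, disk 1 z -> f z != 0) /\
  exists (r : R) (g : R[i] -> R[i]),
    [/\ 1 < r, analytic_on_disk r g, (forall z, disk 1 z -> g z = f z)
      & exists2 zeta, unit_circle zeta & g zeta = 0].

Definition polys (R : realType) (n : nat) : set (R[i] * R[i] -> R[i]) :=
  [set p | exists c : nat -> nat -> R[i],
     p = (fun z => \sum_(k < (2 * n).+1) \sum_(l < (2 * n).+1 | (k + l <= 2 * n)%N)
                     c k l * z.1 ^+ k * z.2 ^+ l)].

Definition dist_one (R : realType) (alpha : R) (F : R[i] * R[i] -> R[i]) (n : nat) :
    \bar R :=
  ereal_inf [set dnorm alpha (fun z => (p z * F z - 1)%R) | p in polys n].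

(* Only meant for 0 <= beta <= 1 and n >= 1. *)
Definition varphi (R : realType) (beta : R) (n : nat) : R :=
  if beta == 1 then \sum_(1 <= j < n.+1) j%:R^-1 else n%:R `^ (1 - beta).

Definition asymp (R : realType) (A : nat -> \bar R) (B : nat -> R) : Prop :=
  exists c1 c2 : R, [/\ 0 < c1, 0 < c2
    & forall n, ((c1 * B n)%:E <= A n <= (c2 * B n)%:E)%E].

(* Main.v *)
(* A polynomial p(z1,z2) f(z1) - 1 has norm at least that of its part depending on z1
   only, so everything reduces to one variable and the weights (k+1)^b, b = alpha - 1.
   There f = Q h with Q the product of 1 - z/w over the zeros w on the circle and 1/h
   absolutely convergent together with its derivatives (Wiener's lemma).  Let
   K m = sum_(k < m) (k+1)^-b, which is comparable to varphi_b(m).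
   Upper bound: let v_w be the reproducing kernel of the polynomials of size m at w,
   divided by its value K m at w.  Then |v_w|^2 = 1 / K m, v_w has absolute coefficient
   sum 1, and prod_w (1 - v_w) is divisible by Q; the quotient times a section of 1/h is
   the approximant.
   Lower bound: (p f - 1) / h is a polynomial multiple of Q minus 1/h; at a zero w of Q
   its sections take values bounded away from 0, while Cauchy-Schwarz bounds them by
   (K N)^(1/2) times the norm. *)
From HB Require Import structures.
Require Import Defs.
From mathcomp Require Import all_boot all_order all_algebra.
From mathcomp Require Import all_classical all_reals all_analysis.
From mathcomp Require cyclic separable cyclotomic.
From mathcomp Require Import ring lra zify.

Set Implicit Arguments.
Unset Strict Implicit.
Unset Printing Implicit Defensive.

Import Order.TTheory GRing.Theory Num.Theory.
Import ComplexField.Normc.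
Import numFieldNormedType.Exports.

Local Open Scope classical_set_scope.
Local Open Scope ring_scope.
Local Open Scope complex_scope.

(** Power series are kept as coefficient sequences under the Cauchy product, so algebraic identities
    are settled by [ring] and convergence enters only when a series is evaluated. Two kinds of
    multiplier must be separated. Multiplication by a is bounded on the weighted sequences as soon
    as a and z a' are absolutely summable; this covers h and 1/h. The derivatives of v_w have no
    such bound uniform in m, so products of the v_w are estimated by a Leibniz-type inequality that
    uses only their absolute sums. Changes of degree cost constants only: (k+1)^-b is nonincreasing,
    hence K(c m) <= c K(m). Cutting 1/h after n+1 terms costs a squared norm O((n+1)^-2), which is
    below 1 / K(n+1) because K(n+1) <= n+1. For cyclicity the estimate is applied at alpha = 2
    alone: the weights grow with alpha, and there K is a harmonic sum, which diverges. *)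

Definition fps (K : comNzRingType) : Type := nat -> K.

(** * The ring of formal power series, dilations and the Euler derivation *)

Section PowerSeriesRing.
Variable K : comNzRingType.
Implicit Types a b c : fps K.

HB.instance Definition _ := GRing.Zmodule.copy (fps K) (nat -> K).

Definition fps_one : fps K := fun k => (k == 0%N)%:R.
Definition fps_mul a b : fps K := fun k => \sum_(i < k.+1) a i * b (k - i)%N.

Definition fps_trunc N a : {poly K} := \poly_(i < N) a i.

(** A coefficient of a product sees only finitely many coefficients of the factors; the ring laws
    are thereby inherited from polynomials. *)
Lemma fps_mul_trunc N a b k : (k < N)%N ->
  fps_mul a b k = (fps_trunc N a * fps_trunc N b)`_k.
Proof.
move=> kN; rewrite coefM; apply: eq_bigr => i _; rewrite !coef_poly.
by rewrite (leq_ltn_trans _ kN) ?leq_ord // (leq_ltn_trans _ kN) ?leq_subr.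
Qed.

Lemma fps_mulC : commutative fps_mul.
Proof.
by move=> a b; apply/funext => k; rewrite !(@fps_mul_trunc k.+1) // mulrC.
Qed.

Lemma fps_mulA : associative fps_mul.
Proof.
move=> a b c; apply/funext => k.
rewrite !(@fps_mul_trunc k.+1) //.
transitivity ((fps_trunc k.+1 a * (fps_trunc k.+1 b * fps_trunc k.+1 c))`_k).
  rewrite !coefM; apply: eq_bigr => i _; congr (_ * _).
  by rewrite coef_poly ltnS leq_subr (@fps_mul_trunc k.+1) // ltnS leq_subr.
rewrite mulrA !coefM; apply: eq_bigr => i _; congr (_ * _).
by rewrite [in RHS]coef_poly ltn_ord (@fps_mul_trunc k.+1).
Qed.

Lemma fps_mul1 : left_id fps_one fps_mul.
Proof.
move=> a; apply/funext => k; rewrite /fps_mul big_ord_recl /= mul1r subn0.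
by rewrite big1 ?addr0 // => i _; rewrite /fps_one /= mul0r.
Qed.

Lemma fps_mulDl : left_distributive fps_mul +%R.
Proof.
move=> a b c; apply/funext => k; rewrite /fps_mul.
under eq_bigr => i _ do rewrite mulrDl.
by rewrite big_split.
Qed.

Lemma fps_one_neq0 : fps_one != 0 :> fps K.
Proof. by apply/eqP => /(congr1 (@^~ 0%N))/eqP; rewrite /fps_one oner_eq0. Qed.

HB.instance Definition _ := GRing.Zmodule_isComNzRing.Build (fps K)
  fps_mulA fps_mulC fps_mul1 fps_mulDl fps_one_neq0.

Lemma fpsME a b k : (a * b) k = \sum_(i < k.+1) a i * b (k - i)%N.
Proof. by []. Qed.

Lemma fpsDE a b k : (a + b) k = a k + b k. Proof. by []. Qed.
Lemma fpsNE a k : (- a) k = - a k. Proof. by []. Qed.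
Lemma fpsBE a b k : (a - b) k = a k - b k. Proof. by []. Qed.
Lemma fps1E k : (1 : fps K) k = (k == 0%N)%:R. Proof. by []. Qed.

Definition fps_poly (p : {poly K}) : fps K := fun k => p`_k.

Lemma fps_polyM p q : fps_poly (p * q) = fps_poly p * fps_poly q.
Proof. by apply/funext => k; rewrite /fps_poly coefM. Qed.

Lemma fps_polyD p q : fps_poly (p + q) = fps_poly p + fps_poly q.
Proof. by apply/funext => k; rewrite /fps_poly coefD. Qed.

Lemma fps_polyN p : fps_poly (- p) = - fps_poly p.
Proof. by apply/funext => k; rewrite /fps_poly coefN. Qed.

Lemma fps_poly1 : fps_poly 1 = 1.
Proof. by apply/funext => k; rewrite /fps_poly coef1. Qed.

(** The series z |-> a(t z). Its terms are also those of a(t), so evaluation at t is written as the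
    plain sum of [dil t a]. *)
Definition dil (t : K) a : fps K := fun k => a k * t ^+ k.

Lemma dilM t a b : dil t (a * b) = dil t a * dil t b.
Proof.
apply/funext => k; rewrite /dil !fpsME mulr_suml; apply: eq_bigr => i _.
by rewrite mulrACA -exprD subnKC // -ltnS.
Qed.

Lemma dil1 t : dil t 1 = 1.
Proof.
by apply/funext => -[|k]; rewrite /dil !fps1E ?expr0 ?mulr1 //= mul0r.
Qed.

Lemma dilD t a b : dil t (a + b) = dil t a + dil t b.
Proof. by apply/funext => k; rewrite /dil !fpsDE mulrDl. Qed.

Lemma dilN t a : dil t (- a) = - dil t a.
Proof. by apply/funext => k; rewrite /dil !fpsNE mulNr. Qed.

Lemma dil_dil s t a : dil s (dil t a) = dil (t * s) a.
Proof. by apply/funext => k; rewrite /dil exprMn mulrA. Qed.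

Lemma dil_id a : dil 1 a = a.
Proof. by apply/funext => k; rewrite /dil expr1n mulr1. Qed.

(* z d/dz *)
Definition euler a : fps K := fun k => a k *+ k.

Lemma eulerM a b : euler (a * b) = euler a * b + a * euler b.
Proof.
apply/funext => k; rewrite /euler fpsDE !fpsME -big_split -sumrMnl.
apply: eq_bigr => i _ /=.
by rewrite mulrnAl mulrnAr -mulrnDr subnKC // -ltnS.
Qed.

Lemma eulerD a b : euler (a + b) = euler a + euler b.
Proof. by apply/funext => k; rewrite /euler !fpsDE mulrnDl. Qed.

Lemma eulerN a : euler (- a) = - euler a.
Proof. by apply/funext => k; rewrite /euler !fpsNE mulNrn. Qed.

Lemma euler1 : euler 1 = 0.
Proof. by apply/funext => -[|k]; rewrite /euler fps1E ?mulr0n ?mul0rn. Qed.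

Lemma dil_euler t a : dil t (euler a) = euler (dil t a).
Proof. by apply/funext => k; rewrite /dil /euler mulrnAl. Qed.

(** Derivatives of an inverse are expressed by [b] itself and derivatives of [h], so that a bound on
    the values of [b] bounds those of its derivatives. *)
Lemma euler_inv b h : b * h = 1 -> euler b = - (b ^+ 2 * euler h).
Proof.
move=> bh; have /(congr1 ( *%R b)) := congr1 euler bh.
rewrite eulerM euler1 => e.
have -> : euler b = b * h * euler b by rewrite bh mul1r.
move: e; rewrite mulrDr mulr0 => /eqP; rewrite addr_eq0 => /eqP e.
have -> : b * h * euler b = b * (euler b * h) by ring.
by rewrite e; ring.
Qed.

Lemma euler2_inv b h : b * h = 1 ->
  euler (euler b) = b ^+ 3 * euler h ^+ 2 *+ 2 - b ^+ 2 * euler (euler h).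
Proof.
move=> bh; have e := euler_inv bh.
rewrite e eulerN eulerM !expr2 eulerM e; ring.
Qed.

Lemma fps_expr_low (x : fps K) n k : x 0%N = 0 -> (k < n)%N -> (x ^+ n) k = 0.
Proof.
move=> x0; elim: n k => // n IH k kn; rewrite exprS fpsME big1 // => -[i ik] _ /=.
case: i ik => [|i] ik; first by rewrite x0 mul0r.
by rewrite IH ?mulr0 //; lia.
Qed.

End PowerSeriesRing.

(** Geometric series: after division by its constant term, [h] is 1 - x with x of positive order. *)
Lemma fps_inv_exists (K : fieldType) (h : fps K) : h 0%N != 0 ->
  exists b : fps K, b * h = 1.
Proof.
move=> h0; pose c := (h 0%N)^-1; pose cs : fps K := fps_poly c%:P.
have csE (a : fps K) k : (cs * a) k = c * a k.
  rewrite fpsME big_ord_recl /= /cs /fps_poly coefC /= subn0 big1 ?addr0 // => i _.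
  by rewrite coefC /= mul0r.
pose x : fps K := 1 - cs * h.
have x0 : x 0%N = 0 by rewrite /x fpsBE fps1E csE /c mulVf //= subrr.
(* Powers of [x] beyond the k-th do not reach the k-th coefficient, so the infinite sum is finite in
   each degree. *)
pose y : fps K := fun k => (\sum_(n < k.+1) x ^+ n : fps K) k.
have yE N k : (k < N)%N -> y k = (\sum_(n < N) x ^+ n : fps K) k.
  move=> kN; rewrite /y -!(big_mkord xpredT (fun n => x ^+ n)).
  rewrite (big_cat_nat (n := k.+1) _ kN) //= fpsDE.
  suff -> : (\sum_(k.+1 <= i < N) x ^+ i : fps K) k = 0 by rewrite addr0.
  rewrite fct_sumE big_nat big1 // => i /andP[ki _].
  by rewrite fps_expr_low.
exists (y * cs); apply/funext => k.
have -> : y * cs * h = y * (1 - x) by rewrite /x; ring.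
transitivity (((\sum_(n < k.+1) x ^+ n) * (1 - x)) k).
  by rewrite !fpsME; apply: eq_bigr => i _; rewrite (yE k.+1).
rewrite mulrC -opprB mulNr -subrX1 opprB fpsBE fps_expr_low // subr0 //.
Qed.

(** * The real-valued modulus on complex numbers *)

Section ComplexNorm.
Variable R : rcfType.
Implicit Types x y z : R[i].

Lemma normc_ge0 z : 0 <= normc z.
Proof. exact: (@normr_ge0 _ (Rcomplex R)). Qed.

Lemma normcB x y : normc (x - y) = normc (y - x).
Proof. by rewrite -normcN opprB. Qed.

Lemma normcX z n : normc (z ^+ n) = normc z ^+ n.
Proof. by elim: n => [|n IH]; rewrite ?normc1 // !exprS normcM IH. Qed.

Lemma normc_sum I (r : seq I) (P : pred I) (F : I -> R[i]) :
  normc (\sum_(i <- r | P i) F i) <= \sum_(i <- r | P i) normc (F i).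
Proof. exact: (@ler_norm_sum _ (Rcomplex R)). Qed.

Lemma normc_real (t : R) : normc t%:C = `|t|.
Proof. by rewrite /normc /= expr0n addr0 sqrtr_sqr. Qed.

Lemma le_normcB x y : normc (x - y) <= normc x + normc y.
Proof. by rewrite (le_trans (le_normcD _ _)) // normcN. Qed.

Lemma normc_le_sub x y : normc x - normc y <= normc (x - y).
Proof. by rewrite lerBlDr (le_trans _ (le_normcD _ _)) // subrK. Qed.

Lemma normcD_sqr x y :
  normc (x + y) ^+ 2 <= 2 * normc x ^+ 2 + 2 * normc y ^+ 2.
Proof.
apply: (@le_trans _ _ ((normc x + normc y) ^+ 2)).
  by rewrite lerXn2r ?nnegrE ?addr_ge0 ?normc_ge0 // le_normcD.
by have := sqr_ge0 (normc x - normc y); rewrite !expr2; lra.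
Qed.

Lemma normc_eq0 z : (normc z == 0) = (z == 0).
Proof. by apply/eqP/eqP => [/eq0_normc//|->]; rewrite normc0. Qed.

Lemma normcConj z : normc z^*%C = normc z.
Proof. by case: z => a b; rewrite /normc /= sqrrN. Qed.

Lemma mulc_conj z : z * z^*%C = (normc z ^+ 2)%:C.
Proof.
case: z => a b; rewrite /normc /= sqr_sqrtr ?addr_ge0 ?sqr_ge0 //.
by apply/eqP; rewrite eq_complex /=; apply/andP; split; apply/eqP; ring.
Qed.

Lemma normc_Re z : `|complex.Re z| <= normc z.
Proof. by rewrite -lecR; apply: normc_ge_Re. Qed.

Lemma normc_Im z : `|complex.Im z| <= normc z.
Proof.
case: z => a b /=; rewrite -(sqrtr_sqr b) ler_wsqrtr // lerDr; exact: sqr_ge0.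
Qed.

Lemma normc_le_ReIm z : normc z <= `|complex.Re z| + `|complex.Im z|.
Proof.
case: z => a b; rewrite -[Complex a b]/(Complex a b).
have -> : Complex a b = a%:C + Complex 0 b.
  by apply/eqP; rewrite eq_complex /= addr0 add0r !eqxx.
apply: le_trans (le_normcD _ _) _; rewrite normc_real /=.
by rewrite expr0n addr0 !add0r sqrtr_sqr.
Qed.

End ComplexNorm.

Lemma nondecreasing_bounded_cauchy (R : realType) (u : nat -> R) (A : R) :
  {homo u : m n / (m <= n)%N >-> m <= n} -> (forall n, u n <= A) ->
  forall e, 0 < e -> exists N, forall n, (N <= n)%N -> u n - u N < e.
Proof.
move=> um uA e e0.
have hs : has_sup (range u) by split; [exists (u 0%N), 0%N|exists A => _ [n _ <-]].
have [_ [N _ <-] hN] := sup_adherent e0 hs.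
exists N => n _; rewrite ltrBlDr.
have : u n <= sup (range u) by apply: sup_upper_bound => //; exists n.
lra.
Qed.

(** * Absolutely convergent series, their products and Cauchy estimates *)

Section ComplexLimits.
Variable R : realType.
Implicit Types (u v : nat -> R[i]) (s t z : R[i]) (a b : fps R[i]).

(** Convergence with real tolerances; the topology of [R[i]^o] takes them among the positive
    elements of [R[i]], which are real. *)
Definition cvgc u s := forall e : R, 0 < e ->
  exists N, forall n, (N <= n)%N -> normc (u n - s) < e.

Lemma cvgcP u s : u @ \oo --> (s : R[i]^o) <-> cvgc u s.
Proof.
have [P Q] := @cvgrPdist_lt _ R[i]^o _ \oo eventually_filter u (s : R[i]^o).
split=> [h e e0|h].
  have /(P h _) [N _ hN] : 0 < e%:C :> R[i] by rewrite ltcR.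
  exists N => n /hN /=; rewrite normcB.
  by rewrite -ltcR.
apply: Q => e e0.
have er : e = (complex.Re e)%:C by rewrite RRe_real // gtr0_real.
have /h [N hN] : 0 < complex.Re e by rewrite -ltcR -er.
by exists N => // n /hN; rewrite normcB -ltcR -er.
Qed.

Lemma cvgc_uniq u s t : cvgc u s -> cvgc u t -> s = t.
Proof.
move=> us ut; apply/eqP; rewrite -subr_eq0 -normc_eq0 eq_le normc_ge0 andbT.
apply/ler_addgt0Pl => e e0; rewrite addr0.
have e2 : 0 < e / 2 by lra.
have [N hN] := us _ e2; have [M hM] := ut _ e2.
have := hN (maxn N M) (leq_maxl _ _); have := hM (maxn N M) (leq_maxr _ _).
have -> : s - t = (u (maxn N M) - t) - (u (maxn N M) - s) by ring.
have := le_normcB (u (maxn N M) - t) (u (maxn N M) - s); lra.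
Qed.

Lemma cvgc_cst s : cvgc (fun=> s) s.
Proof. by move=> e e0; exists 0%N => n _; rewrite subrr normc0. Qed.

Lemma cvgcD u v s t : cvgc u s -> cvgc v t -> cvgc (fun n => u n + v n) (s + t).
Proof.
move=> us vt e e0; have e2 : 0 < e / 2 by lra.
have [N hN] := us _ e2; have [M hM] := vt _ e2.
exists (maxn N M) => n; rewrite geq_max => /andP[/hN h1 /hM h2].
have -> : u n + v n - (s + t) = (u n - s) + (v n - t) by ring.
by apply: le_lt_trans (le_normcD _ _) _; lra.
Qed.

Lemma cvgcZ (c : R[i]) u s : cvgc u s -> cvgc (fun n => c * u n) (c * s).
Proof.
move=> us e e0; have c0 := normc_ge0 c.
have [N hN] := us (e / (normc c + 1)) (divr_gt0 e0 (ltr_wpDl c0 ltr01)).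
exists N => n /hN; rewrite -mulrBr normcM ltr_pdivlMr ?ltr_wpDl // => h.
apply: le_lt_trans h; rewrite mulrC; apply: ler_wpM2l; rewrite ?normc_ge0 //; lra.
Qed.

Lemma cvgcN u s : cvgc u s -> cvgc (fun n => - u n) (- s).
Proof.
by move=> us e /us[N hN]; exists N => n /hN; rewrite -opprD normcN.
Qed.

Lemma cvgc_le u s (M : R) k :
  cvgc u s -> (forall n, (k <= n)%N -> normc (u n) <= M) -> normc s <= M.
Proof.
move=> us uM; apply/ler_addgt0Pl => e /us[N hN].
have := hN (maxn N k) (leq_maxl _ _); have := uM (maxn N k) (leq_maxr _ _).
rewrite normcB; have := normc_le_sub s (u (maxn N k)); lra.
Qed.

Definition sum_to a s := cvgc (fun N => \sum_(k < N) a k) s.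

Definition psum (a : nat -> R[i]) N : R := \sum_(k < N) normc (a k).
Definition l1le a (A : R) := forall N, psum a N <= A.
Definition l1 a := exists A, l1le a A.

Lemma psum_ge0 a N : 0 <= psum a N.
Proof. by apply: sumr_ge0 => i _; apply: normc_ge0. Qed.

Lemma psum_split a m n : (m <= n)%N ->
  psum a n = psum a m + \sum_(m <= k < n) normc (a k).
Proof.
move=> mn; rewrite /psum -!(big_mkord xpredT (fun k => normc (a k))).
by rewrite (big_cat_nat (n := m)).
Qed.

Lemma psum_homo a : {homo psum a : m n / (m <= n)%N >-> m <= n}.
Proof.
move=> m n mn; rewrite (psum_split a mn) lerDl.
by apply: sumr_ge0 => i _; apply: normc_ge0.
Qed.

Lemma l1le_ge0 a A : l1le a A -> 0 <= A.
Proof. by move=> /(_ 0%N); rewrite /psum big_ord0. Qed.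

Lemma le_psum a b N : (forall k, normc (a k) <= normc (b k)) ->
  psum a N <= psum b N.
Proof. by move=> h; apply: ler_sum => i _. Qed.

Lemma l1le_le a b A : (forall k, normc (a k) <= normc (b k)) ->
  l1le b A -> l1le a A.
Proof. by move=> h hb N; apply: le_trans (hb N); apply: le_psum. Qed.

Lemma psumD a b N : psum (a + b) N <= psum a N + psum b N.
Proof. by rewrite -big_split; apply: ler_sum => i _; apply: le_normcD. Qed.

Lemma psumN a N : psum (- a) N = psum a N.
Proof. by apply: eq_bigr => i _; rewrite fpsNE normcN. Qed.

(** The diagonals k < N fill the triangle i + j < N, which is part of the square on the right. *)
Lemma conv_le (x y : nat -> R) N : (forall k, 0 <= x k) -> (forall k, 0 <= y k) ->
  \sum_(k < N) \sum_(i < k.+1) x i * y (k - i)%N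
  <= (\sum_(i < N) x i) * \sum_(j < N) y j.
Proof.
move=> x0 y0; elim: N => [|N _]; first by rewrite !big_ord0 mulr0.
have -> : \sum_(k < N.+1) \sum_(i < k.+1) x i * y (k - i)%N =
  \sum_(i < N.+1) x i * \sum_(j < N.+1 | (i + j <= N)%N) y j.
  pose F (i k : nat) := if (i <= k)%N then x i * y (k - i)%N else 0.
  transitivity (\sum_(k < N.+1) \sum_(i < N.+1) F i k).
    apply: eq_bigr => k _; rewrite (big_ord_widen N.+1 (fun i => x i * y (k - i)%N)) //.
    by rewrite big_mkcond; apply: eq_bigr => i _; rewrite /F ltnS.
  rewrite exchange_big /=; apply: eq_bigr => i _.
  rewrite -(big_mkord xpredT (F i)) (big_cat_nat (n := i)) //=; last exact: ltnW.
  rewrite big_nat big1 ?add0r; last first.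
    by move=> k /andP[_ ki]; rewrite /F leqNgt ki.
  rewrite -{1}[i : nat]add0n big_addn.
  rewrite mulr_sumr -(big_mkord (fun j => i + j <= N)%N (fun j => x i * y j)).
  have iN := ltn_ord i.
  rewrite [RHS](big_cat_nat (n := N.+1 - i)) ?leq_subr //=.
  rewrite [X in _ = _ + X]big_nat_cond [X in _ = _ + X]big1 ?addr0; last by move=> j; lia.
  rewrite [RHS]big_nat_cond [LHS]big_nat_cond; apply: eq_big => [j|j].
    by apply/idP/idP; lia.
  by rewrite /F leq_addl addnK.
rewrite mulr_suml; apply: ler_sum => i _; apply: ler_wpM2l => //.
by rewrite big_mkcond /=; apply: ler_sum => j _; case: ifP.
Qed.

Lemma psumM a b N : psum (a * b) N <= psum a N * psum b N.
Proof.
apply: le_trans (@conv_le (fun k => normc (a k)) (fun k => normc (b k)) N _ _);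
  try by move=> k; apply: normc_ge0.
apply: ler_sum => k _; rewrite fpsME (le_trans (normc_sum _ _ _)) //.
by apply: ler_sum => i _; rewrite normcM.
Qed.

Lemma l1leD a b A B : l1le a A -> l1le b B -> l1le (a + b) (A + B).
Proof. by move=> ha hb N; apply: le_trans (psumD _ _ _) (lerD (ha N) (hb N)). Qed.

Lemma l1leN a A : l1le a A -> l1le (- a) A.
Proof. by move=> ha N; rewrite psumN. Qed.

Lemma l1leM a b A B : l1le a A -> l1le b B -> l1le (a * b) (A * B).
Proof.
move=> ha hb N; apply: le_trans (psumM _ _ _) (ler_pM _ _ (ha N) (hb N));
  exact: psum_ge0.
Qed.

Lemma l1D a b : l1 a -> l1 b -> l1 (a + b).
Proof. by move=> [A hA] [B hB]; exists (A + B); apply: l1leD. Qed.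

Lemma l1N a : l1 a -> l1 (- a).
Proof. by move=> [A hA]; exists A; apply: l1leN. Qed.

Lemma l1M a b : l1 a -> l1 b -> l1 (a * b).
Proof. by move=> [A hA] [B hB]; exists (A * B); apply: l1leM. Qed.

Lemma l1_poly (p : {poly R[i]}) : l1 (fps_poly p).
Proof.
exists (psum (fps_poly p) (size p)) => N.
have [h|/ltnW h] := leqP N (size p); first exact: psum_homo.
rewrite (psum_split _ h) big_nat big1 ?addr0 // => k /andP[k0 _].
by rewrite /fps_poly nth_default // normc0.
Qed.

Lemma l1_one : l1 1.
Proof. by rewrite -fps_poly1; apply: l1_poly. Qed.

Lemma dil_le z a k : normc z <= 1 -> normc (dil z a k) <= normc (a k).
Proof.
move=> z1; rewrite normcM normcX ler_piMr ?normc_ge0 //.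
by rewrite exprn_ile1 // normc_ge0.
Qed.

Lemma l1le_dil z a A : normc z <= 1 -> l1le a A -> l1le (dil z a) A.
Proof. by move=> z1; apply: l1le_le => k; apply: dil_le. Qed.

Lemma l1_dil z a : normc z <= 1 -> l1 a -> l1 (dil z a).
Proof. by move=> z1 [A hA]; exists A; apply: l1le_dil. Qed.

Lemma l1_tail a : l1 a -> forall e : R, 0 < e ->
  exists N, forall n, (N <= n)%N -> \sum_(N <= k < n) normc (a k) < e.
Proof.
move=> [A hA] e e0.
have [N hN] := nondecreasing_bounded_cauchy (@psum_homo a) hA e0.
exists N => n Nn; have := hN n Nn; rewrite (psum_split a Nn); lra.
Qed.

Lemma sum_to_le a s A : l1le a A -> sum_to a s -> normc s <= A.
Proof.
move=> ha hs; apply: (cvgc_le (k := 0%N) hs) => n _.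
exact: le_trans (normc_sum _ _ _) (ha n).
Qed.

(** Real and imaginary parts are dominated by the modulus, so both are absolutely convergent real
    series. *)
Lemma l1_sum_to a : l1 a -> exists s, sum_to a s.
Proof.
move=> ha.
have part (p : R[i] -> R) : {morph p : x y / x + y} -> p 0 = 0 ->
    (forall z, `|p z| <= normc z) ->
    exists t : R, forall e : R, 0 < e -> exists N, forall n, (N <= n)%N ->
      `|p (\sum_(k < n) a k) - t| < e.
  move=> pD p0 ple.
  have cv : cvgn (series (fun k => p (a k))).
    apply: normed_cvg; apply: nondecreasing_is_cvgn.
      apply/nondecreasing_seqP => n; rewrite /= !seriesEord /= big_ord_recr /=.
      rewrite lerDl; exact: normr_ge0.
    case: ha => A hA; exists A => _ [n _ <-]; apply: le_trans (hA n).
    by rewrite /= seriesEord /=; apply: ler_sum => k _.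
  exists (limn (series (fun k => p (a k)))) => e e0.
  have /cvgrPdist_lt /(_ _ e0) [N _ hN] := cv.
  exists N => n /hN /=; rewrite distrC (_ : series _ n = p (\sum_(k < n) a k)) //.
  by rewrite (big_morph p pD p0) seriesEord.
have [|||x hx] := part (@complex.Re R); [by case=> ? ? []|by []|exact: normc_Re|].
have [|||y hy] := part (@complex.Im R); [by case=> ? ? []|by []|exact: normc_Im|].
exists (Complex x y) => e e0; have e2 : 0 < e / 2 by lra.
have [N hN] := hx _ e2; have [M hM] := hy _ e2.
exists (maxn N M) => n; rewrite geq_max => /andP[/hN h1 /hM h2].
apply: le_lt_trans (normc_le_ReIm _) _; move: h1 h2.
by case: (\sum_(k < n) a k) => u v /=; lra.
Qed.

Lemma sum_toD a b s t : sum_to a s -> sum_to b t -> sum_to (a + b) (s + t).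
Proof.
move=> ha hb; have := cvgcD ha hb; rewrite /sum_to; congr (cvgc _ _).
by apply/funext => n; rewrite -big_split.
Qed.

Lemma sum_toN a s : sum_to a s -> sum_to (- a) (- s).
Proof.
move=> ha; have := cvgcN ha; rewrite /sum_to; congr (cvgc _ _).
by apply/funext => n; rewrite -sumrN.
Qed.

Lemma sum_to_poly (p : {poly R[i]}) z : sum_to (dil z (fps_poly p)) p.[z].
Proof.
move=> e e0; exists (size p) => n pn.
rewrite (horner_coef_wide z pn) subrr normc0 //.
Qed.

Lemma sum_to1 z : sum_to (dil z 1) 1.
Proof. by rewrite -fps_poly1 -[X in sum_to _ X](hornerC 1 z); apply: sum_to_poly. Qed.

Lemma l1_approx a A e : l1le a A -> 0 < e ->
  exists p : {poly R[i]}, l1le (fps_poly p) A /\ l1le (a - fps_poly p) e.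
Proof.
move=> hA e0; have [N hN] := l1_tail (ex_intro _ A hA) e0.
have qE k : fps_poly (fps_trunc N a) k = if (k < N)%N then a k else 0.
  by rewrite /fps_poly coef_poly.
exists (fps_trunc N a); split.
  by apply: l1le_le hA => k; rewrite qE; case: ifP => // _; rewrite normc0 normc_ge0.
move=> n; have [nN|Nn] := leqP n N.
  rewrite /psum big1 ?ltW // => k _.
  by rewrite fpsBE qE (leq_trans _ nN) // subrr normc0.
rewrite (psum_split _ (ltnW Nn)) [psum _ _]big1 ?add0r; last first.
  by move=> k _; rewrite fpsBE qE ltn_ord subrr normc0.
apply/ltW/(le_lt_trans _ (hN _ (ltnW Nn))).
rewrite big_nat [leRHS]big_nat; apply: ler_sum => k /andP[kN _].
by rewrite fpsBE qE ltnNge kN subr0.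
Qed.

(** Evaluation is multiplicative on polynomials, and both sides depend continuously on the factors
    for the absolute-sum norm, in which polynomials are dense. *)
Lemma sum_toM a b s t : l1 a -> l1 b ->
  sum_to a s -> sum_to b t -> sum_to (a * b) (s * t).
Proof.
move=> la lb ha hb.
have [A hA] := la; have A0 := l1le_ge0 hA.
have [B hB] := lb; have B0 := l1le_ge0 hB.
have [w hw] := l1_sum_to (l1M la lb).
suff -> : s * t = w by [].
apply/eqP; rewrite -subr_eq0 -normc_eq0 eq_le normc_ge0 andbT.
apply/ler_addgt0Pl => e e0; rewrite addr0.
(* The errors collected below add up to d (2 A + 2 B + 2). *)
pose d := e / (2 * (A + B + 1)).
have d0 : 0 < d by apply: divr_gt0 => //; lra.
have [p [hp hp']] := l1_approx hA d0; have [q [hq hq']] := l1_approx hB d0.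
have P1 (r : {poly R[i]}) : sum_to (fps_poly r) r.[1].
  by rewrite -[fps_poly r]dil_id; apply: sum_to_poly.
have h1 : normc (w - p.[1] * q.[1]) <= A * d + d * B.
  have -> : p.[1] * q.[1] = (p * q).[1] by rewrite hornerM.
  apply: (@sum_to_le (a * b - fps_poly (p * q))); last exact/sum_toD/sum_toN/P1.
  have -> : a * b - fps_poly (p * q) =
    fps_poly p * (b - fps_poly q) + (a - fps_poly p) * b.
    by rewrite fps_polyM; ring.
  by apply: l1leD; apply: l1leM.
have hs : normc (s - p.[1]) <= d.
  by apply: (sum_to_le hp'); apply/sum_toD/sum_toN/P1.
have ht : normc (t - q.[1]) <= d.
  by apply: (sum_to_le hq'); apply/sum_toD/sum_toN/P1.
have hpv : normc p.[1] <= A := sum_to_le hp (P1 p).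
have htv : normc t <= B := sum_to_le hB hb.
have -> : s * t - w = (s - p.[1]) * t + p.[1] * (t - q.[1]) - (w - p.[1] * q.[1]).
  ring.
apply: le_trans (le_normcB _ _) _.
apply: le_trans (lerD (le_normcD _ _) h1) _; rewrite !normcM.
have -> : e = d * B + A * d + (A * d + d * B) + 2 * d.
  by rewrite /d; field; lra.
have : normc (s - p.[1]) * normc t <= d * B by apply: ler_pM; rewrite ?normc_ge0.
have : normc p.[1] * normc (t - q.[1]) <= A * d by apply: ler_pM; rewrite ?normc_ge0.
lra.
Qed.

Lemma prim_root_exists n : (0 < n)%N -> exists w : R[i], n.-primitive_root w.
Proof.
move=> n0; pose p : {poly R[i]} := 'X^n - 1.
have [r Dp] := closed_field_poly_normal p.
rewrite (monicP _) ?monicXnsubC // scale1r in Dp.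
have rn1 : all n.-unity_root r.
  by apply/allP => z; rewrite -root_prod_XsubC -Dp.
have sz_r : (n < (size r).+1)%N by rewrite -(size_prod_XsubC r id) -Dp size_XnsubC.
have [|z] := hasP (cyclic.has_prim_root n0 rn1 _ sz_r); last by exists z.
by rewrite -separable.separable_prod_XsubC -Dp cyclotomic.separable_Xn_sub_1 // pnatr_eq0 -lt0n.
Qed.

Lemma prim_root_normc n (w : R[i]) : (0 < n)%N -> n.-primitive_root w -> normc w = 1.
Proof.
move=> n0 /prim_expr_order /(congr1 (@normc R)); rewrite normcX normc1.
by move/eqP; rewrite pexpr_eq1 ?normc_ge0 // => /eqP.
Qed.

(* The coefficient is the average of [z ^- k * p z] over the [N]-th roots of unity. *)
Lemma cauchy_estimate_poly (c : nat -> R[i]) N M k : (k < N)%N ->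
  (forall z, normc z = 1 -> normc (\sum_(j < N) c j * z ^+ j) <= M) ->
  normc (c k) <= M.
Proof.
move=> kN hM; have N0 : (0 < N)%N by lia.
have [w wN] := prim_root_exists N0.
have w1 := prim_root_normc N0 wN.
have w0 : w != 0 by rewrite -normc_eq0 w1 oner_eq0.
have e : \sum_(m < N) (w ^- k) ^+ m * (\sum_(j < N) c j * (w ^+ m) ^+ j) = c k *+ N.
  under eq_bigr => m _ do rewrite mulr_sumr.
  rewrite exchange_big /= (bigD1 (Ordinal kN)) //= [X in _ + X]big1 ?addr0.
    transitivity (\sum_(m < N) c k); last by rewrite sumr_const card_ord.
    apply: eq_bigr => m _; rewrite mulrCA -exprM mulnC exprM -exprMn.
    by rewrite mulVf ?expr1n ?mulr1 // expf_neq0.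
  move=> j jk; pose x := w ^+ j / w ^+ k.
  have xN : x ^+ N = 1.
    by rewrite exprMn exprVn -!exprM !(mulnC _ N) !exprM (prim_expr_order wN) !expr1n divr1.
  have x1 : x != 1.
    rewrite -subr_eq0 -(inj_eq (mulIf (expf_neq0 k w0))) mul0r mulrBl divfK ?expf_neq0 //.
    rewrite mul1r subr_eq0 (eq_prim_root_expr wN) /= !modn_small //.
  transitivity (c j * \sum_(m < N) x ^+ m).
    rewrite mulr_sumr; apply: eq_bigr => m _; rewrite mulrCA; congr (_ * _).
    by rewrite -exprM mulnC exprM -exprMn mulrC.
  have : (x - 1) * \sum_(m < N) x ^+ m = 0 by rewrite -subrX1 xN subrr.
  by move/eqP; rewrite mulf_eq0 subr_eq0 (negPf x1) /= => /eqP ->; rewrite mulr0.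
have : normc (c k) *+ N <= M *+ N.
  rewrite -normcMn -e (le_trans (normc_sum _ _ _)) //.
  rewrite -[N in leRHS]card_ord -sumr_const; apply: ler_sum => m _.
  rewrite normcM normcX normcV normcX w1 expr1n invr1 expr1n mul1r.
  by apply: hM; rewrite normcX w1 expr1n.
by rewrite lerMn2r; case: N N0 {kN hM wN e}.
Qed.

(** Cutting the series where its absolute tail is below [e] changes its values on the circle by at
    most [e]; the polynomial case then applies. *)
Lemma cauchy_estimate a M k : l1 a ->
  (forall z, normc z = 1 -> exists2 s, sum_to (dil z a) s & normc s <= M) ->
  normc (a k) <= M.
Proof.
move=> la hM; apply/ler_addgt0Pl => e e0; rewrite addrC.
have [N hN] := l1_tail la e0.
apply: (@cauchy_estimate_poly a (maxn N k.+1)); first exact: leq_maxr.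
move=> z z1; have [s hs sM] := hM z z1.
set n := maxn _ _; pose r : fps R[i] := fun k => if (k < n)%N then 0 else dil z a k.
have nN : (N <= n)%N by exact: leq_maxl.
have rs : sum_to r (s - \sum_(k < n) dil z a k).
  move=> d d0; have [m hm] := hs d d0; exists (maxn m n) => p.
  rewrite geq_max => /andP[mp np]; have := hm p mp.
  rewrite -!(big_mkord xpredT) (big_cat_nat (n := n)) //=.
  rewrite [\sum_(0 <= i < p) r i](big_cat_nat (n := n)) //=.
  have -> : \sum_(0 <= i < n) r i = 0.
    by rewrite big_nat big1 // => i /andP[_ i1]; rewrite /r i1.
  have -> : \sum_(n <= i < p) r i = \sum_(n <= i < p) dil z a i.
    by rewrite big_nat [RHS]big_nat; apply: eq_bigr => i /andP[ni _]; rewrite /r ltnNge ni.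
  rewrite add0r big_mkord; congr (normc _ < _); ring.
have rl : l1le r e.
  move=> p; have [pn|np] := leqP p n.
    by rewrite /psum big1 ?ltW // => i _; rewrite /r (leq_trans _ pn) // normc0.
  rewrite (psum_split _ (ltnW np)) [psum _ _]big1 ?add0r; last first.
    by move=> i _; rewrite /r ltn_ord normc0.
  apply: le_trans (ltW (hN p (leq_trans nN (ltnW np)))).
  rewrite [leRHS](big_cat_nat (n := n)) //=; last exact: ltnW.
  apply: ler_wpDl; first by apply: sumr_ge0 => *; exact: normc_ge0.
  rewrite big_nat [leRHS]big_nat; apply: ler_sum => i /andP[ni _].
  by rewrite /r ltnNge ni /= dil_le // z1.
have := sum_to_le rl rs; rewrite normcB.
by have := normc_le_sub (\sum_(k0 < n) dil z a k0) s; rewrite /dil; lra.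
Qed.

End ComplexLimits.

(** * Wiener's lemma for series with two summable derivatives *)

Section NonvanishingSeries.
Variable R : realType.
Implicit Types (a b h : fps R[i]) (z w s : R[i]).

Lemma l1X a n : l1 a -> l1 (a ^+ n).
Proof.
move=> la; elim: n => [|n IH]; first exact: l1_one.
by rewrite exprS; apply: l1M.
Qed.

Lemma sum_to_uniq a s w : sum_to a s -> sum_to a w -> s = w.
Proof. exact: cvgc_uniq. Qed.

(** Telescoping: 1/(n+2)^2 is at most 1/(n+1) - 1/(n+2). *)
Lemma sum_inv_sqr_le n :
  \sum_(k < n.+1) ((k.+1%:R : R) ^- 2) <= 2 - n.+1%:R^-1.
Proof.
elim: n => [|n IH]; first by rewrite big_ord_recl big_ord0 expr1n invr1; lra.
rewrite big_ord_recr /=; apply: le_trans (lerD IH (lexx _)) _.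
have n1 : 0 < n.+1%:R :> R by rewrite ltr0n.
have n2 : 0 < n.+2%:R :> R by rewrite ltr0n.
have e : n.+2%:R = n.+1%:R + 1 :> R by rewrite -natr1.
have : n.+2%:R ^- 2 <= n.+1%:R^-1 - n.+2%:R^-1 :> R.
  rewrite -subr_ge0.
  have -> : n.+1%:R^-1 - n.+2%:R^-1 - n.+2%:R ^- 2 =
      (n.+1%:R * n.+2%:R ^+ 2)^-1 :> R.
    rewrite e; move: n.+1%:R n1 => x x0; field.
    by apply/andP; split; apply: lt0r_neq0 => //; apply: addr_gt0.
  by rewrite invr_ge0 mulr_ge0 ?exprn_ge0 // ltW.
by move: (n.+2%:R ^- 2) (n.+1%:R^-1) (n.+2%:R^-1) => u v w; lra.
Qed.

Lemma subX_le (z w : R[i]) k : normc z <= 1 -> normc w <= 1 ->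
  normc (z ^+ k - w ^+ k) <= k%:R * normc (z - w).
Proof.
move=> z1 w1; elim: k => [|k IH]; first by rewrite !expr0 subrr normc0 mul0r.
have -> : z ^+ k.+1 - w ^+ k.+1 = z * (z ^+ k - w ^+ k) + (z - w) * w ^+ k.
  by rewrite !exprS; ring.
apply: le_trans (le_normcD _ _) _; rewrite !normcM -natr1 mulrDl mul1r.
apply: lerD.
  by apply: le_trans IH; rewrite ler_piMl ?normc_ge0.
by rewrite ler_piMr ?normc_ge0 // normcX exprn_ile1 ?normc_ge0.
Qed.

(** Dilation is Lipschitz in its parameter, since |z^k - w^k| <= k |z - w| on the closed disk. *)
Lemma dilB_le h M z w : l1le (euler h) M -> normc z <= 1 -> normc w <= 1 ->
  l1le (dil z h - dil w h) (M * normc (z - w)).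
Proof.
move=> hM z1 w1 N; apply: le_trans (ler_wpM2r (normc_ge0 _) (hM N)).
rewrite mulr_suml; apply: ler_sum => k _.
rewrite fpsBE /dil -mulrBr normcM /euler normcMn mulrnAl -mulrnAr.
apply: ler_wpM2l; first exact: normc_ge0.
by rewrite -mulr_natl subX_le.
Qed.

(** An a priori bound: summability of [b] is assumed but its size does not enter. On the circle |b|
    <= 1/m, which bounds the second Euler derivative there by [E]; Cauchy's estimate gives |b_k| <=
    E / k^2, and the sum of 1/k^2 is at most 2. *)
Lemma l1_inverse_bound b h m M1 M2 : b * h = 1 -> l1 b -> l1 h ->
    l1le (euler h) M1 -> l1le (euler (euler h)) M2 -> 0 < m ->
    (forall z s, normc z = 1 -> sum_to (dil z h) s -> m <= normc s) ->
  l1le b (m^-1 + 2 * (m ^- 3 * M1 ^+ 2 *+ 2 + m ^- 2 * M2)).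
Proof.
move=> bh lb lh h1 h2 m0 hm.
have M10 := l1le_ge0 h1; have M20 := l1le_ge0 h2.
set E := _ + _ * M2.
have vals z : normc z = 1 -> exists2 s, sum_to (dil z b) s & normc s <= m^-1.
  move=> z1; have z1' : normc z <= 1 by rewrite z1.
  have [s hs] := l1_sum_to (l1_dil z1' lb); exists s => //.
  have [w hw] := l1_sum_to (l1_dil z1' lh).
  have sw : s * w = 1.
    have := sum_toM (l1_dil z1' lb) (l1_dil z1' lh) hs hw.
    by rewrite -dilM bh => /sum_to_uniq; apply; apply: sum_to1.
  have := hm z w z1 hw; have : normc s * normc w = 1 by rewrite -normcM sw normc1.
  have w0 : 0 < normc w by apply: lt_le_trans m0 (hm z w z1 hw).
  move=> e mw; have -> : normc s = (normc w)^-1.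
    by apply: (mulIf (lt0r_neq0 w0)); rewrite e mulVf // lt0r_neq0.
  by rewrite lef_pV2.
have c0 : normc (b 0%N) <= m^-1 by apply: (cauchy_estimate 0%N lb vals).
have E0 : 0 <= E.
  have i0 n : 0 <= m ^- n by rewrite invr_ge0 exprn_ge0 // ltW.
  by rewrite addr_ge0 ?mulrn_wge0 ?mulr_ge0 // exprn_ge0.
have cE k : normc (euler (euler b) k) <= E.
  have le1 : l1 (euler h) by exists M1.
  have le2 : l1 (euler (euler h)) by exists M2.
  have lbb : l1 (b ^+ 3 * euler h ^+ 2 *+ 2).
    by rewrite mulr2n; apply: l1D; apply/l1M/l1X/le1/l1X/lb.
  have lb2 : l1 (b ^+ 2 * euler (euler h)) by apply/l1M/le2/l1X/lb.
  apply: cauchy_estimate => [|z z1].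
    by rewrite (euler2_inv bh); apply/l1D/l1N.
  have z1' : normc z <= 1 by rewrite z1.
  have [s hs sm] := vals z z1.
  have [u hu] := l1_sum_to (l1_dil z1' le1).
  have [v hv] := l1_sum_to (l1_dil z1' le2).
  have uM : normc u <= M1 by apply: sum_to_le hu; apply: l1le_dil.
  have vM : normc v <= M2 by apply: sum_to_le hv; apply: l1le_dil.
  have lbz := l1_dil z1' lb; have l1z := l1_dil z1' le1; have l2z := l1_dil z1' le2.
  exists (s ^+ 3 * u ^+ 2 *+ 2 - s ^+ 2 * v).
    rewrite (euler2_inv bh).
    have -> : b ^+ 3 * euler h ^+ 2 *+ 2 - b ^+ 2 * euler (euler h) =
      (b * (b * b) * (euler h * euler h) + b * (b * b) * (euler h * euler h))
      - b * b * euler (euler h) by ring.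
    have -> : s ^+ 3 * u ^+ 2 *+ 2 - s ^+ 2 * v =
      s * (s * s) * (u * u) + s * (s * s) * (u * u) - s * s * v by ring.
    rewrite !dilD dilN !dilM.
    have S2 : sum_to (dil z b * dil z b) (s * s) by apply: sum_toM.
    have S3 : sum_to (dil z b * (dil z b * dil z b)) (s * (s * s)).
      by apply: sum_toM => //; apply: l1M.
    have U2 : sum_to (dil z (euler h) * dil z (euler h)) (u * u) by apply: sum_toM.
    have T : sum_to (dil z b * (dil z b * dil z b) *
        (dil z (euler h) * dil z (euler h))) (s * (s * s) * (u * u)).
      by apply: sum_toM => //; do ?apply: l1M.
    apply: sum_toD; first exact: sum_toD.
    by apply/sum_toN/sum_toM => //; apply: l1M.
  apply: le_trans (le_normcB _ _) _; rewrite normcMn.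
  rewrite (normcM (s ^+ 3)) (normcM (s ^+ 2)) !(normcX s) (normcX u).
  apply: lerD.
    rewrite lerMn2r /= ; apply: ler_pM; rewrite ?exprn_ge0 ?normc_ge0 //.
      by rewrite -exprVn lerXn2r ?nnegrE ?normc_ge0 ?invr_ge0 ?(ltW m0).
    by rewrite lerXn2r ?nnegrE ?normc_ge0.
  apply: ler_pM; rewrite ?exprn_ge0 ?normc_ge0 //.
  by rewrite -exprVn lerXn2r ?nnegrE ?normc_ge0 ?invr_ge0 ?(ltW m0).
case=> [|N].
  by rewrite /psum big_ord0 addr_ge0 ?mulr_ge0 // invr_ge0 ltW.
rewrite /psum big_ord_recl; apply: lerD => //.
have ck k : normc (b k.+1) <= E * k.+1%:R ^- 2.
  rewrite ler_pdivlMr ?exprn_gt0 ?ltr0n //; apply: le_trans (cE k.+1).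
  have -> : normc (euler (euler b) k.+1) = normc (b k.+1) *+ k.+1 *+ k.+1.
    by rewrite /euler !normcMn.
  by rewrite -(mulr_natr (_ *+ _)) -(mulr_natr (normc _)) expr2 mulrA.
apply: (@le_trans _ _ (\sum_(k < N) E * k.+1%:R ^- 2)).
  by apply: ler_sum => k _; apply: ck.
rewrite -mulr_sumr mulrC; apply: ler_wpM2r => //.
case: N => [|N]; first by rewrite big_ord0.
by apply: le_trans (sum_inv_sqr_le N) _; rewrite gerBl invr_ge0.
Qed.

(* Continuity method along the dilations [t |-> h (t z)]: the a priori bound of
   [l1_inverse_bound] makes the admissible step size uniform. *)
Lemma l1_inverse b h m : b * h = 1 -> l1 h -> l1 (euler h) ->
    l1 (euler (euler h)) -> 0 < m ->
    (forall z s, normc z <= 1 -> sum_to (dil z h) s -> m <= normc s) ->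
  l1 b.
Proof.
move=> bh lh [M1 h1] [M2 h2] m0 hm.
have M10 := l1le_ge0 h1.
set B := m^-1 + 2 * (m ^- 3 * M1 ^+ 2 *+ 2 + m ^- 2 * M2).
have bound z : normc z <= 1 -> l1 (dil z b) -> l1le (dil z b) B.
  move=> z1 lb; apply: (@l1_inverse_bound _ (dil z h)) => //.
  - by rewrite -dilM bh dil1.
  - exact: l1_dil.
  - by rewrite -dil_euler; apply: l1le_dil.
  - by rewrite -!dil_euler; apply: l1le_dil.
  move=> u s u1; rewrite dil_dil; apply: hm.
  by rewrite normcM u1 mulr1.
have B0 : l1 (dil 0 b).
  suff -> : dil 0 b = fps_poly (b 0%N)%:P by apply: l1_poly.
  by apply/funext => -[|k]; rewrite /dil /fps_poly coefC ?expr0 ?mulr1 //= expr0n mulr0.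
have Bge : 0 <= B.
  by apply: l1le_ge0 (bound 0 _ B0); rewrite normc0.
clearbody B.
(* The parameter runs from 0 to 1 in n+1 equal steps. Each one moves the dilate of [h] by at most M1
   / (n+1) in absolute sum, and [B] times this is at most 1/2. *)
have [n hn] : exists n : nat, 2 * (B * M1) < n.+1%:R.
  exists (Num.truncn (2 * (B * M1))).
  by rewrite truncnS_gt.
pose t (j : nat) : R[i] := (j%:R / n.+1%:R)%:C.
have n0 : 0 < n.+1%:R :> R by rewrite ltr0n.
have t1 j : (j <= n.+1)%N -> normc (t j) <= 1.
  move=> jn; rewrite /t normc_real ger0_norm ?divr_ge0 //.
  by rewrite ler_pdivrMr // mul1r ler_nat.
suff H j : (j <= n.+1)%N -> l1 (dil (t j) b).
  have := H n.+1 (leqnn _); rewrite /t divff ?lt0r_neq0 //.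
  by rewrite -[_%:C]/(1 : R[i]) dil_id.
elim: j => [|j IH] jn; first by rewrite /t mul0r.
have lj := bound _ (t1 j (ltnW jn)) (IH (ltnW jn)).
set g := dil (t j) b in lj; set c := dil (t j.+1) b.
pose e := dil (t j.+1) h - dil (t j) h.
have he : l1le e (M1 / n.+1%:R).
  have -> : n.+1%:R^-1 = normc (t j.+1 - t j).
    have -> : t j.+1 - t j = (n.+1%:R^-1)%:C.
      rewrite /t -rmorphB /=; congr (_%:C).
      by rewrite -mulrBl -natrB // subSnn mul1r.
    by rewrite normc_real ger0_norm // invr_ge0 ltW.
  by apply: dilB_le => //; apply: t1 => //; apply: ltnW.
(* Resolvent identity. It bounds a partial sum of [c] by [B] plus half of the same partial sum, so
   summability of [c] is not presupposed. *)
have ce : c = g - g * e * c.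
  have e1 : g * dil (t j) h = 1 by rewrite -dilM bh dil1.
  have e2 : c * dil (t j.+1) h = 1 by rewrite -dilM bh dil1.
  have -> : g * e * c = g * (c * dil (t j.+1) h) - (g * dil (t j) h) * c by rewrite /e; ring.
  by rewrite e1 e2; ring.
exists (2 * B) => N.
have : psum c N <= B + B * (M1 / n.+1%:R) * psum c N.
  rewrite {1}ce; apply: le_trans (psumD _ _ _) _; rewrite psumN.
  apply: lerD; first exact: lj.
  apply: le_trans (psumM _ _ _) _; apply: ler_wpM2r; first exact: psum_ge0.
  apply: le_trans (psumM _ _ _) _.
  by apply: ler_pM; rewrite ?psum_ge0.
have : B * (M1 / n.+1%:R) <= 1 / 2 
  by rewrite mulrA ler_pdivrMr //; move: (B * M1) n.+1%:R hn => u v; lra.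
by move: (psum_ge0 c N); move: (psum c N) (B * (M1 / _)) => u v; nra.
Qed.

(** Compactness: if the values came arbitrarily close to 0, a cluster point of the arguments would
    be a zero, by the Lipschitz bound [dilB_le]. *)
Lemma modulus_lower_bound h : l1 h -> l1 (euler h) ->
    (forall z, normc z <= 1 -> ~ sum_to (dil z h) 0) ->
  exists2 m : R, 0 < m &
    forall z s, normc z <= 1 -> sum_to (dil z h) s -> m <= normc s.
Proof.
move=> lh [M hM] hz; apply: contrapT => hn.
have M0 := l1le_ge0 hM.
have small (n : nat) : exists zs : R[i] * R[i],
    [/\ normc zs.1 <= 1, sum_to (dil zs.1 h) zs.2 & normc zs.2 < n.+1%:R^-1].
  apply: contrapT => hc; apply: hn; exists n.+1%:R^-1; first by rewrite invr_gt0 ltr0n.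
  move=> z s z1 hs; rewrite leNgt; apply/negP => sn; apply: hc.
  by exists (z, s).
have [zs hzs] := choice small.
pose p n : R * R := (complex.Re (zs n).1, complex.Im (zs n).1).
(* The closed disk is placed inside a real square, where compactness of products of segments
   applies. *)
have cK : compact (`[(-1 : R), 1]%classic `*` `[(-1 : R), 1]%classic).
  by apply: compact_setX; apply: segment_compact.
have [|[x y] [_ cl]] := cK (p @ \oo) _.
  exists 0%N => // n _; have [z1 _ _] := hzs n.
  split; rewrite /= in_itv /= -ler_norml; apply: le_trans z1; [exact: normc_Re|exact: normc_Im].
have near (e : R) N : 0 < e ->
    exists2 n, (N <= n)%N & normc (Complex x y - (zs n).1) < e.
  move=> e0; have e2 : 0 < e / 2 by lra.
  pose V := ball x (e / 2) `*` ball y (e / 2).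
  have Vn : nbhs (x, y) V.
    by exists (ball x (e / 2), ball y (e / 2)) => //; split; exact: nbhsx_ballx.
  have Fn : (p @ \oo) (p @` [set n | (N <= n)%N]) by exists N => // n Nn; exists n.
  have [q [[n Nn <-] [bx by_]]] := cl _ _ Fn Vn.
  exists n => //; apply: le_lt_trans (normc_le_ReIm _) _; move: bx by_.
  by rewrite /ball /= /p; case: (zs n).1 => u v /=; lra.
have xy1 : normc (Complex x y) <= 1.
  apply/ler_addgt0Pr => e e0; have [n _ hn'] := near e 0%N e0.
  have [z1 _ _] := hzs n; have := normc_le_sub (Complex x y) (zs n).1; lra.
have [w hw] := l1_sum_to (l1_dil xy1 lh).
apply: (hz _ xy1); suff <- : w = 0 by [].
apply/eqP; rewrite -normc_eq0 eq_le normc_ge0 andbT.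
apply/ler_addgt0Pl => e e0; rewrite addr0.
have [N hN] : exists N : nat, 2 / e < N.+1%:R.
  by exists (Num.truncn (2 / e)); rewrite truncnS_gt.
(* One half of [e] goes to the Lipschitz term, the other to the value at the nearby point; [N] was
   chosen for the latter. *)
have d0 : 0 < e / (2 * (M + 1)) by rewrite divr_gt0 //; lra.
have [n Nn hn'] := near _ N d0.
have [z1 hs sn] := hzs n.
have := sum_to_le (dilB_le hM xy1 z1) (sum_toD hw (sum_toN hs)).
have : M * normc (Complex x y - (zs n).1) <= e / 2.
  apply: le_trans (ler_wpM2l M0 (ltW hn')) _.
  rewrite mulrA ler_pdivrMr; last lra.
  by have := ltW e0; nra.
have : normc (zs n).2 < e / 2.
  apply: lt_le_trans sn _; rewrite -[e / 2]invrK lef_pV2 ?posrE ?invr_gt0 ?ltr0n //; last lra.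
  rewrite invf_div; apply: le_trans (ltW hN) _; by rewrite ler_nat ltnS.
have := normc_le_sub w (zs n).2; lra.
Qed.

End NonvanishingSeries.

(** * Splitting off the finitely many zeros on the unit circle *)

Section UnimodularFactorization.
Variable R : realType.
Implicit Types (a b h : fps R[i]) (z w s : R[i]) (r q : R).

Lemma bernoulli_ge (x : R) n : 0 <= x -> n%:R * x <= (1 + x) ^+ n.
Proof.
move=> x0; suff : 1 + n%:R * x <= (1 + x) ^+ n by apply: le_trans; rewrite lerDr.
elim: n => [|n IH]; first by rewrite mul0r expr0; lra.
rewrite exprS; apply: le_trans (ler_wpM2l _ IH); last lra.
rewrite -natr1; have : 0 <= n%:R :> R by []; move: n%:R => y y0.
by have := mulr_ge0 y0 (sqr_ge0 x); rewrite expr2; lra.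
Qed.

(* [h] is [O(r ^- k)]: this class, unlike absolute convergence at radius [r], is
   kept unchanged by the extraction of a zero in [div_unimodular]. *)
Definition geo r h := exists A : R, forall k, normc (h k) * r ^+ k <= A.

Lemma geo_dil r h q : 0 <= q < r -> geo r h -> l1 (dil q%:C h).
Proof.
move=> /andP[q0 qr] [A hA].
have r0 : 0 < r by apply: le_lt_trans qr.
have A0 : 0 <= A by apply: le_trans (hA 0%N); rewrite mulr_ge0 ?normc_ge0 ?exprn_ge0 ?ltW.
have x1 : q / r < 1 by rewrite ltr_pdivrMr // mul1r.
have x0 : 0 <= q / r by rewrite divr_ge0 // ltW.
exists (A / (1 - q / r)) => N.
have d0 : 0 < 1 - q / r by rewrite subr_gt0.
rewrite ler_pdivlMr //.
apply: (@le_trans _ _ ((\sum_(k < N) A * (q / r) ^+ k) * (1 - q / r))).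
  apply: ler_wpM2r; first exact: ltW.
  apply: ler_sum => k _; rewrite normcM normcX normc_real (ger0_norm q0).
  rewrite expr_div_n mulrA ler_pdivlMr ?exprn_gt0 // mulrAC.
  by apply: ler_wpM2r; rewrite ?exprn_ge0.
rewrite -mulr_sumr -mulrA [X in _ * X]mulrC -opprB mulNr -subrX1 opprB.
by apply: ler_piMr => //; rewrite gerBl exprn_ge0.
Qed.

(** The factor k is absorbed by shrinking the radius: k (r/q - 1) <= (r/q)^k by Bernoulli. *)
Lemma geo_euler r q h : 0 <= q < r -> geo r h -> geo q (euler h).
Proof.
move=> /andP[q0 qr] [A hA].
have r0 : 0 < r by apply: le_lt_trans qr.
have A0 : 0 <= A by apply: le_trans (hA 0%N); rewrite mulr_ge0 ?normc_ge0 ?exprn_ge0 ?ltW.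
have [->|qn0] := eqVneq q 0.
  exists 0 => -[|k]; first by rewrite /euler mulr0n normc0 mul0r.
  by rewrite exprS mul0r mulr0.
have qp : 0 < q by rewrite lt_neqAle eq_sym qn0.
have x0 : 0 < r / q - 1 by rewrite subr_gt0 ltr_pdivlMr // mul1r.
exists (A / (r / q - 1)) => k.
rewrite ler_pdivlMr // /euler normcMn -mulr_natr.
have e : k%:R * (r / q - 1) <= r ^+ k / q ^+ k.
  have := bernoulli_ge k (ltW x0); rewrite addrCA subrr addr0 exprMn exprVn //.
have -> : normc (h k) * k%:R * q ^+ k * (r / q - 1) =
   normc (h k) * (k%:R * (r / q - 1) * q ^+ k) by ring.
apply: le_trans (hA k); apply: ler_wpM2l; first exact: normc_ge0.
by rewrite -ler_pdivlMr // exprn_gt0.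
Qed.

Lemma geo_l1 r h : 1 < r -> geo r h ->
  [/\ l1 h, l1 (euler h) & l1 (euler (euler h))].
Proof.
move=> r1 hr.
have lin q b : 1 < q -> geo q b -> l1 b.
  by move=> q1 /(@geo_dil _ _ 1); rewrite ler01 q1 dil_id; apply.
pose q1 := (1 + r) / 2; pose q2 := (1 + q1) / 2.
have h1 : geo q1 (euler h) by apply: geo_euler hr; rewrite /q1; lra.
have h2 : geo q2 (euler (euler h)) by apply: geo_euler h1; rewrite /q2 /q1; lra.
by split; [apply: lin hr|apply: lin h1|apply: lin h2]; rewrite /q2 /q1; lra.
Qed.

Definition lin_fac w : {poly R[i]} := 1 - (w^-1)%:P * 'X.

Lemma horner_lin_fac w z : (lin_fac w).[z] = 1 - w^-1 * z.
Proof. by rewrite /lin_fac !hornerE. Qed.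

(** As the whole series sums to 0 at [w], a partial sum is minus the remaining tail, which is
    geometric. *)
Lemma geo_tail r A h w k : 1 < r -> (forall k, normc (h k) * r ^+ k <= A) ->
  normc w = 1 -> sum_to (dil w h) 0 ->
  normc (\sum_(i < k.+1) dil w h i) * r ^+ k <= A / (r - 1).
Proof.
move=> r1 hA w1 h0.
have r0 : 0 < r by apply: lt_trans r1.
have r10 : 0 < r - 1 by rewrite subr_gt0.
have tl n : (k.+1 <= n)%N ->
    \sum_(k.+1 <= i < n) normc (dil w h i) <= A / (r - 1) * (r ^- k - r ^- n.-1).
  elim: n => // n IH; rewrite leq_eqVlt => /orP[/eqP [->]|].
    by rewrite big_geq // subrr mulr0.
  rewrite ltnS => kn; rewrite big_nat_recr //=; apply: le_trans (lerD (IH kn) (lexx _)) _.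
  case: n kn {IH} => // n _ /=.
  have : normc (dil w h n.+1) <= A * r ^- n.+1.
    by rewrite ler_pdivlMr ?exprn_gt0 // normcM normcX w1 expr1n mulr1.
  have -> : r ^- n = r * r ^- n.+1.
    by rewrite exprS invfM mulrA divff ?mul1r // lt0r_neq0.
  move: (r ^- n.+1) (r ^- k) (normc _) => x y v hv.
  have -> : A / (r - 1) * (y - x) = A / (r - 1) * (y - r * x) + A * x.
    by field; apply: lt0r_neq0.
  by rewrite lerD2l.
rewrite -ler_pdivlMr ?exprn_gt0 //.
set S := \sum_(i < _) _.
have hS : cvgc (fun n => \sum_(i < n) dil w h i - S) (0 - S).
  by apply: cvgcD h0 (cvgc_cst _).
rewrite -normcN -sub0r.
apply: (cvgc_le (k := k.+1) hS) => n kn.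
have -> : \sum_(i < n) dil w h i - S = \sum_(k.+1 <= i < n) dil w h i.
  rewrite /S -!(big_mkord xpredT) [X in X - _](big_cat_nat (n := k.+1) _ kn) //=.
  by rewrite [X in X - _]addrC addrK.
apply: le_trans (normc_sum _ _ _) _; apply: le_trans (tl n kn) _.
have A0 : 0 <= A by apply: le_trans (hA 0%N); rewrite mulr_ge0 ?normc_ge0 ?exprn_ge0 ?ltW.
have Ar : 0 <= A / (r - 1) by rewrite divr_ge0 // ltW.
by apply: ler_wpM2l => //; rewrite gerBl invr_ge0 exprn_ge0 // ltW.
Qed.

Lemma div_unimodular r h w : 1 < r -> geo r h -> normc w = 1 ->
  sum_to (dil w h) 0 -> exists2 h1, geo r h1 & h = fps_poly (lin_fac w) * h1.
Proof.
move=> r1 [A hA] w1 h0.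
have w0 : w != 0 by rewrite -normc_eq0 w1 oner_eq0.
(* The Cauchy product of [h] with 1/(1 - z/w), whose k-th coefficient is w^-k. *)
exists (fun k => w ^- k * \sum_(i < k.+1) dil w h i).
  exists (A / (r - 1)) => k; rewrite normcM normcV normcX w1 expr1n invr1 mul1r.
  exact: geo_tail.
apply/funext => k; rewrite fpsME.
have cE i : fps_poly (lin_fac w) i = (i == 0%N)%:R - w^-1 * (i == 1%N)%:R.
  by rewrite /fps_poly /lin_fac coefB coef1 coefCM coefX.
apply/esym; rewrite big_ord_recl cE /= mulr0 subr0 mul1r subn0.
case: k => [|k].
  rewrite big_ord0 addr0 big_ord_recl big_ord0 addr0 expr0 invr1 mul1r /dil expr0 mulr1 //.
rewrite [X in _ + X = _]big_ord_recl cE /= mulr1 sub0r.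
rewrite [X in _ + (_ + X) = _]big1 ?addr0; last first.
  by move=> i _; rewrite cE /= mulr0 subr0 mul0r.
rewrite big_ord_recr /= /bump /= subn1 /=.
rewrite mulNr mulrA -invfM -exprS mulrDr addrC addKr /dil mulrCA mulVf ?mulr1 //.
by rewrite expf_neq0.
Qed.

(** As 1/w is the conjugate of w and |z| = q, the left factor is z/q times the conjugate of z -
    w. *)
Lemma lin_fac_reflect w z q : normc w = 1 -> normc z = q -> 0 < q ->
  normc (q%:C - w^-1 * z / q%:C) = normc (1 - w^-1 * z).
Proof.
move=> w1 zq q0.
have wV : w^-1 = w^*%C.
  have w0 : w != 0 by rewrite -normc_eq0 w1 oner_eq0.
  apply: (mulfI w0); rewrite divff // mulc_conj w1 expr1n //.
have q0' : q%:C != 0 :> R[i] by rewrite -normc_eq0 normc_real normr_eq0 lt0r_neq0.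
have -> : q%:C - w^-1 * z / q%:C = z / q%:C * (z - w)^*%C.
  rewrite rmorphB /= mulrBr wV; congr (_ - _).
    by rewrite mulrAC mulc_conj zq rmorphXn /= expr2 mulfK.
  by rewrite [RHS]mulrAC [z * _]mulrC.
rewrite !normcM normcConj normcV normc_real gtr0_norm // zq divff ?lt0r_neq0 // mul1r.
have -> : 1 - w^-1 * z = w^-1 * (w - z).
  by rewrite mulrBr mulVf // -normc_eq0 w1 oner_eq0.
by rewrite normcM normcV w1 invr1 mul1r normcB.
Qed.

Definition unimodular_poly (zs : seq R[i]) := \prod_(w <- zs) lin_fac w.

(* Jensen: replacing each factor [1 - z / w] by its reflection in the circle of
   radius [q > 1] keeps the modulus there and multiplies the value at 0 by [q]. *)
Lemma card_unimodular_zeros r (q A : R) a h zs : 1 < q < r -> geo r h ->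
    all (fun w => normc w == 1) zs -> a = fps_poly (unimodular_poly zs) * h ->
    l1le (dil q%:C a) A ->
  normc (a 0%N) * q ^+ size zs <= A.
Proof.
move=> /andP[q1 qr] hr zs1 aE hA.
have q0 : 0 < q by apply: lt_trans q1.
have q0' : q%:C != 0 :> R[i] by rewrite -normc_eq0 normc_real normr_eq0 lt0r_neq0.
pose b : {poly R[i]} := \prod_(w <- zs) (q%:C%:P - (w^-1 / q%:C)%:P * 'X).
have lh : l1 (dil q%:C h) by apply: geo_dil hr; rewrite ltW.
have lP (p : {poly R[i]}) : l1 (dil q%:C (fps_poly p)).
  suff -> : dil q%:C (fps_poly p) = fps_poly (p \Po (q%:C *: 'X)) by apply: l1_poly.
  apply/funext => k; rewrite /dil /fps_poly comp_polyE coef_sum.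
  under eq_bigr => i _ do rewrite exprZn scalerA coefZ coefXn.
  have [kp|pk] := ltnP k (size p).
    rewrite (bigD1 (Ordinal kp)) //= eqxx mulr1 big1 ?addr0 // => i ik.
    by rewrite (_ : (k == i) = false) ?mulr0 //; apply/negbTE; rewrite eq_sym.
  rewrite nth_default // mul0r big1 // => i _.
  rewrite (_ : (k == i) = false) ?mulr0 //.
  by apply/negbTE; rewrite gtn_eqF // (leq_trans _ pk).
have lb := lP b.
pose G := dil q%:C (fps_poly b * h).
have G0 : normc (G 0%N) = normc (a 0%N) * q ^+ size zs.
  rewrite /G /dil aE expr0 mulr1 !fpsME !big_ord_recl !big_ord0 !addr0 /= !normcM.
  rewrite mulrAC; congr (_ * _); rewrite /fps_poly -!horner_coef0 /unimodular_poly /b.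
  rewrite !horner_prod; elim: zs zs1 {aE G lb b} => [|w zs IH] /=.
    by rewrite !big_nil normc1 expr0 mulr1.
  move=> /andP[_ /IH e].
  have e0 : (q%:C%:P - (w^-1 / q%:C)%:P * 'X).[0] = q%:C by rewrite !hornerE subr0.
  have e1 : (lin_fac w).[0] = 1 by rewrite horner_lin_fac mulr0 subr0.
  rewrite !big_cons !normcM e e0 e1 normc1 mul1r normc_real gtr0_norm //.
  by rewrite exprS [RHS]mulrCA mulrA.
rewrite -G0; apply: cauchy_estimate; first by rewrite /G dilM; apply: l1M.
move=> z z1; have z1' : normc z <= 1 by rewrite z1.
have [s hs] := l1_sum_to (l1_dil z1' lh).
have evP (p : {poly R[i]}) : sum_to (dil z (dil q%:C (fps_poly p))) p.[q%:C * z].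
  by rewrite dil_dil; apply: sum_to_poly.
exists (b.[q%:C * z] * s).
  by rewrite /G !dilM; apply: sum_toM => //; apply: l1_dil.
have : sum_to (dil z (dil q%:C a)) ((unimodular_poly zs).[q%:C * z] * s).
  by rewrite aE !dilM; apply: sum_toM => //; apply: l1_dil.
move/(sum_to_le (l1le_dil z1' hA)); apply: le_trans.
rewrite !normcM le_eqVlt; apply/orP; left; apply/eqP; congr (_ * _).
rewrite /unimodular_poly /b !horner_prod.
elim: zs zs1 {aE G G0 lb b} => [|w zs IH] /=; first by rewrite !big_nil.
move=> /andP[/eqP w1 /IH e]; rewrite !big_cons !normcM e; congr (_ * _).
have -> : (q%:C%:P - (w^-1 / q%:C)%:P * 'X).[q%:C * z] =
    q%:C - w^-1 * (q%:C * z) / q%:C.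
  by rewrite hornerD hornerN hornerCM hornerX hornerC [in RHS]mulrAC.
rewrite horner_lin_fac; apply: lin_fac_reflect => //.
by rewrite normcM z1 mulr1 normc_real gtr0_norm.
Qed.

(** Zeros are removed one at a time. If this never stopped, [card_unimodular_zeros] would give
    |a(0)| q^d <= A for every d, with a fixed q > 1. *)
Lemma unimodular_factorization r a : 1 < r -> geo r a -> a 0%N != 0 ->
  exists zs h, [/\ all (fun w => normc w == 1) zs, geo r h,
    a = fps_poly (unimodular_poly zs) * h &
    forall w, normc w = 1 -> ~ sum_to (dil w h) 0].
Proof.
move=> r1 ar a0; apply: contrapT => hn.
have step d : exists zs h, [/\ size zs = d, all (fun w => normc w == 1) zs, geo r h &
    a = fps_poly (unimodular_poly zs) * h].
  elim: d => [|d [zs [h [sz zs1 hr aE]]]].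
    by exists [::], a; split => //; rewrite /unimodular_poly big_nil fps_poly1 mul1r.
  have [w w1 hw] : exists2 w, normc w = 1 & sum_to (dil w h) 0.
    apply: contrapT => hc; apply: hn; exists zs, h; split => // w w1 hw.
    by apply: hc; exists w.
  have [h1 h1r hE] := div_unimodular r1 hr w1 hw.
  exists (w :: zs), h1; split => //=; first by rewrite sz.
    by rewrite w1 eqxx.
  by rewrite aE {1}hE /unimodular_poly big_cons fps_polyM; ring.
pose q := (1 + r) / 2.
have [A hA] : l1 (dil q%:C a) by apply: geo_dil ar; rewrite /q; lra.
have q1 : 0 < q - 1 by rewrite /q; lra.
have na : 0 < normc (a 0%N) by rewrite lt_neqAle eq_sym normc_eq0 a0 normc_ge0.
(* Chosen so that |a(0)| d (q - 1) > A, while q^d >= d (q - 1) by Bernoulli. *)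
pose d := (Num.truncn (A / (normc (a 0%N) * (q - 1)))).+1.
have [zs [h [sz zs1 hr aE]]] := step d.
have qr : 1 < q < r by rewrite /q; lra.
have := card_unimodular_zeros qr hr zs1 aE hA; rewrite sz.
have : A / (normc (a 0%N) * (q - 1)) < d%:R by rewrite /d truncnS_gt.
rewrite ltr_pdivrMr ?mulr_gt0 //.
have := bernoulli_ge d (ltW q1); rewrite addrCA subrr addr0.
move: (q ^+ d) (d%:R) => x y; rewrite mulrCA => h1 h2 h3.
by have := ler_wpM2l (ltW na) h1; lra.
Qed.

End UnimodularFactorization.

(** * Multipliers on weighted square-summable sequences, and the one-variable distance estimates *)

Section WeightedSequences.
Variable R : realType.
Implicit Types (a b h g : fps R[i]) (z w : R[i]).

Lemma eq_ler (x y : R) : x = y -> x <= y.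
Proof. by move=> ->. Qed.

(** Expansion of the nonnegative sum of x_i (X y_i - S)^2. *)
Lemma weighted_cauchy_schwarz n (x y : nat -> R) : (forall i, 0 <= x i) ->
  (\sum_(i < n) x i * y i) ^+ 2
  <= (\sum_(i < n) x i) * \sum_(i < n) x i * y i ^+ 2.
Proof.
move=> x0; set S := \sum_(i < n) _ * _; set X := \sum_(i < n) x i.
set Q := \sum_(i < n) _ * _ ^+ 2.
have X0 : 0 <= X by apply: sumr_ge0.
have [X00|Xn] := eqVneq X 0.
  suff -> : S = 0 by rewrite X00 expr0n mul0r.
  rewrite /S big1 // => i _.
  have /eqP : X = 0 by [].
  by rewrite psumr_eq0 // => /allP /(_ i (mem_index_enum _)) /eqP ->; rewrite mul0r.
have Xp : 0 < X by rewrite lt_neqAle eq_sym Xn.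
have : 0 <= \sum_(i < n) x i * (X * y i - S) ^+ 2.
  by apply: sumr_ge0 => i _; rewrite mulr_ge0 ?sqr_ge0.
have -> : \sum_(i < n) x i * (X * y i - S) ^+ 2 = X * (X * Q - S ^+ 2).
  transitivity (\sum_(i < n) (X ^+ 2 * (x i * y i ^+ 2) +
      ((- 2 * X * S) * (x i * y i) + S ^+ 2 * x i))).
    by apply: eq_bigr => i _; ring.
  rewrite !big_split /= -!mulr_sumr -/S -/Q -/X; ring.
by rewrite pmulr_rge0 // subr_ge0.
Qed.

(** Young's inequality for the convolution of a summable and a square-summable sequence:
    Cauchy-Schwarz with weights [x], then [conv_le] for [x] and the squares of [y]. *)
Lemma young_l1_l2 N (x y u : nat -> R) :
    (forall k, 0 <= x k) -> (forall k, 0 <= y k) -> (forall k, 0 <= u k) ->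
    (forall k, u k <= \sum_(i < k.+1) x i * y (k - i)%N) ->
  \sum_(k < N) u k ^+ 2 <= (\sum_(i < N) x i) ^+ 2 * \sum_(j < N) y j ^+ 2.
Proof.
move=> x0 y0 u0 hu; set X := \sum_(i < N) x i.
have X0 : 0 <= X by apply: sumr_ge0.
apply: (@le_trans _ _ (\sum_(k < N) X * \sum_(i < k.+1) x i * y (k - i)%N ^+ 2)).
  apply: ler_sum => k _.
  apply: (@le_trans _ _ ((\sum_(i < k.+1) x i * y (k - i)%N) ^+ 2)).
    by apply: lerXn2r; rewrite ?nnegrE // (le_trans (u0 k)).
  apply: le_trans (weighted_cauchy_schwarz _ (fun i => y (k - i)%N) x0) _.
  apply: ler_wpM2r; first by apply: sumr_ge0 => i _; rewrite mulr_ge0 ?sqr_ge0.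
  rewrite (big_ord_widen N x) // big_mkcond /=.
  by apply: ler_sum => i _; case: ifP.
rewrite -mulr_sumr expr2 -mulrA; apply: ler_wpM2l => //.
by apply: (@conv_le _ x (fun k => y k ^+ 2)) => // k; apply: sqr_ge0.
Qed.

(** Of the [c] consecutive blocks of length [m], the first has the largest sum. *)
Lemma sum_dilate_le (x : nat -> R) c m : (forall k, 0 <= x k) ->
  {homo x : i j / (i <= j)%N >-> j <= i} ->
  \sum_(k < c * m) x k <= c%:R * \sum_(k < m) x k.
Proof.
move=> x0 xm; elim: c => [|c IH]; first by rewrite mul0n big_ord0 mul0r.
rewrite mulSn big_split_ord /= -natr1 mulrDl mul1r addrC lerD2r.
by apply: le_trans IH; apply: ler_sum => i _; apply: xm; apply: leq_addl.
Qed.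

Lemma euler_addE a k : normc ((a + euler a) k) = k.+1%:R * normc (a k).
Proof. by rewrite fpsDE /euler -mulrS normcMn mulr_natl. Qed.

(* The last two conditions bound the norm of a product, in the manner of the
   Leibniz rule, resp. the norm of a shift. *)
Definition weight (s : nat -> R) := [/\ s 0%N = 1,
  {homo s : i j / (i <= j)%N >-> i <= j},
  forall i j, s (i + j)%N <= s i + s j &
  forall i j, s (i + j)%N <= i.+1%:R * s j].

Definition l2le (s : nat -> R) a (B : R) :=
  forall N, \sum_(k < N) (s k * normc (a k)) ^+ 2 <= B.

Definition inv_sqr_sum (s : nat -> R) m := \sum_(k < m) s k ^- 2.

Variable s : nat -> R.
Hypothesis sW : weight s.

Lemma weight_ge1 k : 1 <= s k.
Proof. by have [<- sm _ _] := sW; apply: sm. Qed.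

Lemma weight_gt0 k : 0 < s k.
Proof. exact: lt_le_trans ltr01 (weight_ge1 k). Qed.

Let s_ge0 k : 0 <= s k. Proof. exact/ltW/weight_gt0. Qed.

Lemma l2le_ge0 a B : l2le s a B -> 0 <= B.
Proof. by move=> /(_ 0%N); rewrite big_ord0. Qed.

Lemma l2le_le a B B' : B <= B' -> l2le s a B -> l2le s a B'.
Proof. by move=> BB h N; apply: le_trans BB. Qed.

Lemma l2leD a b A B : l2le s a A -> l2le s b B -> l2le s (a + b) (2 * (A + B)).
Proof.
move=> ha hb N; apply: le_trans (ler_wpM2l _ (lerD (ha N) (hb N))); last by [].
rewrite -big_split mulr_sumr; apply: ler_sum => k _ /=.
have := ler_wpM2l (sqr_ge0 (s k)) (normcD_sqr (a k) (b k)).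
by rewrite !exprMn fpsDE => /le_trans; apply; apply/eq_ler; ring.
Qed.

Lemma l2leN a A : l2le s a A -> l2le s (- a) A.
Proof. by move=> ha N; under eq_bigr => k _ do rewrite fpsNE normcN. Qed.

Lemma l2le_one : l2le s 1 1.
Proof.
case=> [|N]; first by rewrite big_ord0.
have [s0 _ _ _] := sW.
rewrite big_ord_recl s0 mul1r [normc _](normc1 R) expr1n big1 ?addr0 // => k _.
by rewrite [normc _](normc0 R) mulr0 expr0n.
Qed.

(** The bound s(i + j) <= (i + 1) s(j) moves the weight onto [b] at the price of a factor i + 1 on
    the i-th coefficient of [a]; Young's inequality finishes. *)
Lemma l2leM_euler a b A B : l1le (a + euler a) A -> l2le s b B ->
  l2le s (a * b) (A ^+ 2 * B).
Proof.
move=> ha hb N; have [_ _ _ sM] := sW.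
have sn0 (c : fps R[i]) k : 0 <= s k * normc (c k) by rewrite mulr_ge0 ?normc_ge0.
have hu k : s k * normc ((a * b) k) <=
    \sum_(i < k.+1) normc ((a + euler a) i) * (s (k - i)%N * normc (b (k - i)%N)).
  rewrite fpsME; apply: le_trans (ler_wpM2l (s_ge0 k) (normc_sum _ _ _)) _.
  rewrite mulr_sumr; apply: ler_sum => i _; rewrite normcM euler_addE.
  have := sM i (k - i)%N; rewrite subnKC; last by rewrite -ltnS.
  move=> h; rewrite [leRHS]mulrACA; apply: ler_wpM2r => //.
  by rewrite mulr_ge0 ?normc_ge0.
apply: le_trans (@young_l1_l2 N (fun k => normc ((a + euler a) k))
   (fun k => s k * normc (b k)) (fun k => s k * normc ((a * b) k))
   (fun=> normc_ge0 _) (sn0 b) (sn0 (a * b)) hu) _.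
apply: ler_pM => //; rewrite ?sqr_ge0 //.
  by apply: sumr_ge0 => *; apply: sqr_ge0.
apply: lerXn2r; rewrite ?nnegrE ?(l1le_ge0 ha) //; last exact: ha.
by apply: sumr_ge0 => *; apply: normc_ge0.
Qed.

(** The bound s(i + j) <= s(i) + s(j) puts the weight on one factor at a time, so no derivative has
    to be summable. This serves the bumps, whose differentiated absolute sums grow with their
    size. *)
Lemma l2leM_l1 a b A B A' B' : l1le a A -> l1le b B -> l2le s a A' -> l2le s b B' ->
  l2le s (a * b) (2 * (A ^+ 2 * B' + B ^+ 2 * A')).
Proof.
move=> ha hb ha' hb' N; have [_ _ sD _] := sW.
pose u k := \sum_(i < k.+1) normc (a i) * (s (k - i)%N * normc (b (k - i)%N)).
pose v k := \sum_(i < k.+1) normc (b i) * (s (k - i)%N * normc (a (k - i)%N)).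
have u0 k : 0 <= u k.
  by apply: sumr_ge0 => i _; rewrite !mulr_ge0 ?normc_ge0.
have v0 k : 0 <= v k.
  by apply: sumr_ge0 => i _; rewrite !mulr_ge0 ?normc_ge0.
have sn0 (c : fps R[i]) k : 0 <= s k * normc (c k) by rewrite mulr_ge0 ?normc_ge0.
have le k : s k * normc ((a * b) k) <= u k + v k.
  have -> : v k = \sum_(i < k.+1) normc (b (k - i)%N) * (s i * normc (a i)).
    rewrite /v (reindex_inj rev_ord_inj) /=; apply: eq_bigr => i _.
    by rewrite subSS subKn // -ltnS.
  rewrite -big_split fpsME; apply: le_trans (ler_wpM2l (s_ge0 k) (normc_sum _ _ _)) _.
  rewrite mulr_sumr; apply: ler_sum => i _ /=; rewrite normcM.
  have := sD i (k - i)%N; rewrite subnKC; last by rewrite -ltnS.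
  move=> h.
  apply: (le_trans (ler_wpM2r (mulr_ge0 (normc_ge0 _) (normc_ge0 _)) h)).
  by apply/eq_ler; ring.
apply: (@le_trans _ _ (\sum_(k < N) 2 * (u k ^+ 2 + v k ^+ 2))).
  apply: ler_sum => k _; apply: (@le_trans _ _ ((u k + v k) ^+ 2)).
    by apply: lerXn2r; rewrite ?nnegrE ?addr_ge0.
  by have := sqr_ge0 (u k - v k); rewrite !expr2; lra.
rewrite -mulr_sumr big_split; apply: ler_wpM2l => //.
have Y (c d : fps R[i]) C D : l1le c C -> l2le s d D ->
   \sum_(k < N) (\sum_(i < k.+1) normc (c i) * (s (k - i)%N * normc (d (k - i)%N))) ^+ 2
     <= C ^+ 2 * D.
  move=> hc hd.
  have w0 k : 0 <= \sum_(i < k.+1) normc (c i) * (s (k - i)%N * normc (d (k - i)%N)).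
    by apply: sumr_ge0 => i _; rewrite !mulr_ge0 ?normc_ge0.
  apply: le_trans (@young_l1_l2 N (fun k => normc (c k)) (fun k => s k * normc (d k))
    _ (fun=> normc_ge0 _) (sn0 d) w0 (fun=> lexx _)) _.
  apply: ler_pM => //; rewrite ?sqr_ge0 //.
    by apply: sumr_ge0 => *; apply: sqr_ge0.
  apply: lerXn2r; rewrite ?nnegrE ?(l1le_ge0 hc) //; last exact: hc.
  by apply: sumr_ge0 => *; apply: normc_ge0.
by apply: lerD; apply: Y.
Qed.

Local Notation K := (inv_sqr_sum s).

Lemma inv_sqr_weight_ge0 k : 0 <= s k ^- 2.
Proof. by rewrite invr_ge0 sqr_ge0. Qed.

Lemma inv_sqr_weight_homo : {homo (fun k => s k ^- 2) : i j / (i <= j)%N >-> j <= i}.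
Proof.
have [_ sm _ _] := sW.
move=> i j ij; rewrite lef_pV2 ?posrE ?exprn_gt0 ?weight_gt0 //.
by apply: lerXn2r; rewrite ?nnegrE // sm.
Qed.

Lemma inv_sqr_sum_homo : {homo K : m n / (m <= n)%N >-> m <= n}.
Proof.
move=> m n mn; rewrite /inv_sqr_sum -!(big_mkord xpredT (fun k => s k ^- 2)).
rewrite [leRHS](big_cat_nat (n := m)) //= lerDl.
by apply: sumr_ge0 => i _; apply: inv_sqr_weight_ge0.
Qed.

Lemma inv_sqr_sum_ge1 m : (0 < m)%N -> 1 <= K m.
Proof.
have [s0 _ _ _] := sW.
case: m => // m _; rewrite /inv_sqr_sum big_ord_recl s0 expr1n invr1 lerDl.
by apply: sumr_ge0 => i _; apply: inv_sqr_weight_ge0.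
Qed.

Lemma inv_sqr_sum_le m : K m <= m%:R.
Proof.
rewrite -[m in leRHS]card_ord -sumr_const; apply: ler_sum => i _.
by rewrite invf_le1 ?exprn_gt0 ?weight_gt0 // exprn_ege1 // weight_ge1.
Qed.

Lemma inv_sqr_sum_mul c m : K (c * m) <= c%:R * K m.
Proof.
exact: (@sum_dilate_le (fun k => s k ^- 2) c m inv_sqr_weight_ge0 inv_sqr_weight_homo).
Qed.

(* [1 - v] is the extremal polynomial of size [m] vanishing at [w]: [v] is the
   reproducing kernel at [w], normalized at [w]. *)
Lemma unimodular_bump w m : normc w = 1 -> (0 < m)%N ->
  exists v q : {poly R[i]}, [/\ 1 - v = lin_fac w * q, (size q <= m.-1.+1)%N,
    l1le (fps_poly v) 1 & l2le s (fps_poly v) (K m)^-1].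
Proof.
move=> w1 m0; have w0 : w != 0 by rewrite -normc_eq0 w1 oner_eq0.
have K0 : 0 < K m by apply: lt_le_trans ltr01 (inv_sqr_sum_ge1 m0).
pose c k : R := s k ^- 2 / K m.
have c0 k : 0 <= c k by rewrite divr_ge0 ?inv_sqr_weight_ge0 // ltW.
pose v := \poly_(k < m) ((c k)%:C * w ^- k).
have nv k : normc (fps_poly v k) = if (k < m)%N then c k else 0.
  rewrite /fps_poly coef_poly; case: ifP => _; last exact: normc0.
  by rewrite normcM normc_real normcV normcX w1 expr1n invr1 mulr1 ger0_norm.
have cut (F : nat -> R) N : (forall k, 0 <= F k) ->
    \sum_(k < N) (if (k < m)%N then F k else 0) <= \sum_(k < m) F k.
  move=> F0; have [Nm|/ltnW mN] := leqP N m.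
    rewrite (big_ord_widen m (fun k => if (k < m)%N then F k else 0) Nm) big_mkcond /=.
    by apply: ler_sum => k _; rewrite ltn_ord; case: ifP.
  by rewrite [leRHS](big_ord_widen N F mN) [leRHS]big_mkcond lexx.
have v1 : root (1 - v) w.
  rewrite rootE !hornerE; have -> : v.[w] = 1; last by rewrite subrr.
  rewrite /v horner_poly.
  under eq_bigr => k _ do rewrite mulfVK ?expf_neq0 //.
  by rewrite -rmorph_sum -mulr_suml divff ?lt0r_neq0.
have [q qE] := factor_theorem _ _ v1.
have lE : lin_fac w = (- w^-1)%:P * ('X - w%:P).
  rewrite mulrBr -polyCM mulNr mulVf // polyCN mulNr polyCN opprK addrC.
  by rewrite /lin_fac polyC1.
(* The factor -w turns the monic divisor X - w into 1 - X/w. *)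
exists v, ((- w)%:P * q); split.
- rewrite lE qE mulrACA -polyCM mulNr mulrN opprK mulVf // polyC1 mul1r mulrC //.
- have [->|q0] := eqVneq q 0; first by rewrite mulr0 size_poly0.
  rewrite size_Cmul ?oppr_eq0 //.
  have : (size (1 - v)%R <= m)%N.
    apply: leq_trans (size_polyD _ _) _; rewrite geq_max size_polyN size_poly1 m0 /=.
    exact: size_poly.
  rewrite qE size_Mmonic ?monicXsubC // size_XsubC addn2 prednK //= => /ltnW qm; exact: qm.
- move=> N.
  have -> : psum (fps_poly v) N = \sum_(k < N) (if (k < m)%N then c k else 0).
    by apply: eq_bigr => k _; rewrite nv.
  by apply: le_trans (cut c N c0) _; rewrite -mulr_suml divff // lt0r_neq0.
move=> N; apply: (@le_trans _ _ (\sum_(k < m) (s k * c k) ^+ 2)).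
  apply: le_trans (cut (fun k => (s k * c k) ^+ 2) N _) => [|k]; last exact: sqr_ge0.
  apply: ler_sum => k _; rewrite nv; case: ifP => // _.
  by rewrite mulr0 expr0n.
(* Summing over k < m gives K / K^2 = 1 / K, the squared norm of the normalized kernel. *)
have e (k : 'I_m) : true -> (s k * c k) ^+ 2 = s k ^- 2 * (K m) ^- 2.
  move=> _; have := weight_gt0 k => s0.
  by rewrite /c; field; rewrite !lt0r_neq0.
rewrite (eq_bigr _ e) -mulr_suml expr2 invfM mulrA divff ?lt0r_neq0 //.
by rewrite mul1r.
Qed.

(** 1 - Y is the product of the 1 - v over the zeros with multiplicity. Each new factor changes Y
    into Y + v - Y v, which keeps the absolute sum bounded and the squared norm of order 1 / K. *)
Lemma unimodular_poly_approx (zs : seq R[i]) : all (fun w => normc w == 1) zs ->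
  exists A C : R, 0 <= C /\ forall m, (0 < m)%N -> exists Y q : {poly R[i]},
    [/\ 1 - Y = unimodular_poly zs * q, (size q <= (size zs * m.-1).+1)%N,
        l1le (fps_poly Y) A & l2le s (fps_poly Y) (C / K m)].
Proof.
elim: zs => [_|w zs IH /= /andP[/eqP w1 /IH [A [C [C0 hAC]]]]].
  exists 0, 0; split => // m m0; exists 0, 1.
  have z0 : fps_poly 0 = 0 :> fps R[i] by apply/funext => k; rewrite /fps_poly coef0.
  split; rewrite ?mul0r ?z0 ?size_poly1 //.
  - by rewrite /unimodular_poly big_nil subr0 mulr1.
  - by move=> N; rewrite /psum big1 // => k _; rewrite normc0.
  - by move=> N; rewrite big1 // => k _; rewrite normc0 mulr0 expr0n.
exists (A + 1 + A * 1), (2 * (2 * (C + 1) + 2 * (A ^+ 2 + C))); split.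
  by rewrite ?mulr_ge0 ?addr_ge0 ?mulr_ge0 ?addr_ge0 ?sqr_ge0.
move=> m m0; have [Y [q [YE qs YA YC]]] := hAC m m0.
have [v [q1 [vE q1s v1 vK]]] := unimodular_bump w1 m0.
have e : fps_poly (Y + v - Y * v) = fps_poly Y + fps_poly v - fps_poly Y * fps_poly v.
  by rewrite fps_polyD fps_polyN fps_polyD fps_polyM.
exists (Y + v - Y * v), (q * q1); split.
- have -> : 1 - (Y + v - Y * v) = (1 - Y) * (1 - v) by ring.
  by rewrite YE vE /unimodular_poly big_cons; ring.
- apply: leq_trans (size_polyMleq _ _) _; rewrite -subn1.
  by apply: leq_trans (leq_sub2r 1 (leq_add qs q1s)) _; rewrite mulSn; lia.
- by rewrite e; apply: l1leD; [apply: l1leD|apply/l1leN/l1leM].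
have := l2leD (l2leD YC vK) (l2leN (l2leM_l1 YA v1 YC vK)).
rewrite e; apply: l2le_le; apply/eq_ler; rewrite expr1n; ring.
Qed.

(** With r the tail of g = 1/h beyond degree n, the error is Y + r h (1 - Y). Multiplication by r
    has norm O(1/(n+1)), so Y dominates. *)
Lemma one_variable_upper (zs : seq R[i]) h g a : all (fun w => normc w == 1) zs ->
    a = fps_poly (unimodular_poly zs) * h -> g * h = 1 ->
    l1 (h + euler h) -> l1 (g + euler g + euler (g + euler g)) ->
  exists C : R, forall n, exists2 p : {poly R[i]}, (size p <= (2 * n).+1)%N &
    l2le s (1 - fps_poly p * a) (C / K n.+1).
Proof.
move=> zs1 aE gh [H hH] [G hG].
have [A [C [C0 hC]]] := unimodular_poly_approx zs1.
set d := size zs in hC.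
have G0 := l1le_ge0 hG; have H0 := l1le_ge0 hH.
exists (2 * (C * d.+1%:R + G ^+ 2 * (H ^+ 2 * (2 * (1 + C))))) => n.
(* Both needs are met: d (m - 1) <= n leaves degree n for the section of [g] within the total 2 n,
   and (d + 1) m >= n + 1 makes K(n + 1) at most (d + 1) K(m). *)
pose m := (n %/ d.+1).+1.
have m0 : (0 < m)%N by [].
have dm : (d * m.-1 <= n)%N.
  by apply: leq_trans (leq_trunc_div n d.+1); rewrite mulnC leq_mul2l leqnSn orbT.
have nm : (n.+1 <= d.+1 * m)%N by rewrite mulnC /m ltn_ceil.
have [Y [q [YE qs YA YC]]] := hC m m0.
pose gn := fps_trunc n.+1 g.
exists (q * gn).
  apply: leq_trans (size_polyMleq _ _) _; rewrite -subn1.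
  by apply: leq_trans (leq_sub2r 1 (leq_add qs (size_poly n.+1 g))) _; lia.
have K0 : 0 < K m by apply: lt_le_trans ltr01 (inv_sqr_sum_ge1 m0).
have Kn : 0 < K n.+1 by apply: lt_le_trans ltr01 (inv_sqr_sum_ge1 _).
pose r : fps R[i] := g - fps_poly gn.
(* On the tail n + 1 <= k + 1, so one further Euler derivative of [g] pays for the factor
   1/(n+1). *)
have nr : l1le (r + euler r) (G / n.+1%:R).
  move=> N; apply: (@le_trans _ _ (psum (g + euler g + euler (g + euler g)) N / n.+1%:R)).
    rewrite /psum mulr_suml; apply: ler_sum => k _.
    rewrite !euler_addE ler_pdivlMr ?ltr0n // /r fpsBE /fps_poly coef_poly.
    have [kn|nk] := ltnP k n.+1.
      by rewrite subrr normc0 mulr0 mul0r !mulr_ge0 ?normc_ge0.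
    rewrite subr0 mulrC; apply: ler_wpM2r; first by rewrite mulr_ge0 ?normc_ge0.
    by rewrite ler_nat; apply: ltnW.
  by apply: ler_wpM2r; rewrite ?invr_ge0.
have e : 1 - fps_poly (q * gn) * a = fps_poly Y + r * (h * (1 - fps_poly Y)).
  have e1 : fps_poly (unimodular_poly zs) * fps_poly q = 1 - fps_poly Y.
    by rewrite -fps_polyM -YE fps_polyD fps_polyN fps_poly1.
  have e2 : fps_poly gn = g - r by rewrite /r; ring.
  rewrite fps_polyM aE e2.
  have -> : fps_poly q * (g - r) * (fps_poly (unimodular_poly zs) * h) =
     (fps_poly (unimodular_poly zs) * fps_poly q) * (g * h - r * h) by ring.
  by rewrite e1 gh; ring.
have K1 : (K m)^-1 <= d.+1%:R / K n.+1.
  rewrite ler_pdivlMr // mulrC ler_pdivrMr //.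
  by apply: le_trans (inv_sqr_sum_mul _ _); apply: inv_sqr_sum_homo.
have CK : C / K m <= C by apply: ler_piMr => //; rewrite invf_le1 // inv_sqr_sum_ge1.
have := l2leD YC (l2leM_euler nr (l2leM_euler hH (l2leD l2le_one (l2leN YC)))).
rewrite -e; apply: l2le_le; rewrite -[leRHS]mulrA; apply: ler_wpM2l => //.
rewrite [leRHS]mulrDl; apply: lerD; first by rewrite -mulrA; apply: ler_wpM2l.
rewrite [leRHS]mulrAC; apply: ler_pM.
- by rewrite sqr_ge0.
- by rewrite !mulr_ge0 ?sqr_ge0 // addr_ge0 // divr_ge0 // ltW.
- rewrite expr_div_n; apply: ler_wpM2l; first exact: sqr_ge0.
  rewrite lef_pV2 ?posrE ?exprn_gt0 ?ltr0n //.
  apply: le_trans (inv_sqr_sum_le _) _; rewrite expr2 ler_peMl ?ler0n // ler1n //.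
by apply: ler_wpM2l; rewrite ?sqr_ge0 // ler_pM2l // lerD2l.
Qed.

(** Multiplying 1 - p a by g = 1/h gives g - p Q. Since Q(w) = 0, a section at w long enough to
    contain p Q is a section of g, close to g(w), which is nonzero. *)
Lemma one_variable_lower (zs : seq R[i]) w h g a : all (fun w => normc w == 1) zs ->
    w \in zs -> a = fps_poly (unimodular_poly zs) * h -> g * h = 1 ->
    l1 h -> l1 g -> l1 (g + euler g) ->
  exists2 c : R, 0 < c & forall n (p : {poly R[i]}) B, (size p <= (2 * n).+1)%N ->
    l2le s (1 - fps_poly p * a) B -> c / K n.+1 <= B.
Proof.
move=> zs1 wzs aE gh lh lg [G hG].
have w1 : normc w = 1 by apply/eqP; apply: (allP zs1).
have w1' : normc w <= 1 by rewrite w1.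
have [y hy] := l1_sum_to (l1_dil w1' lg).
have [x hx] := l1_sum_to (l1_dil w1' lh).
have yx : y * x = 1.
  have := sum_toM (l1_dil w1' lg) (l1_dil w1' lh) hy hx.
  by rewrite -dilM gh => /sum_to_uniq; apply; apply: sum_to1.
have y0 : 0 < normc y.
  rewrite lt_neqAle eq_sym normc_ge0 normc_eq0 andbT.
  by apply: contra_eq_neq yx => ->; rewrite mul0r eq_sym oner_eq0.
have y2 : 0 < normc y / 2 by rewrite divr_gt0.
have [M hM] := hy _ y2.
have G0 := l1le_ge0 hG.
set Q := unimodular_poly zs in aE.
have Qw : Q.[w] = 0.
  rewrite /Q /unimodular_poly horner_prod; apply/eqP; rewrite prodf_seq_eq0.
  by apply/hasP; exists w => //=; rewrite horner_lin_fac mulVf ?subrr // -normc_eq0 w1 oner_eq0.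
(* The length c (n + 1) exceeds both the size of p Q and the index [M] beyond which sections of [g]
   at [w] are close to [y]. *)
pose c := (2 + size Q + M)%N.
have c0 : 0 < c%:R :> R by rewrite ltr0n.
exists ((normc y / 2) ^+ 2 / ((G + 1) ^+ 2 * c%:R)).
  by rewrite divr_gt0 ?exprn_gt0 ?mulr_gt0 ?exprn_gt0 ?divr_gt0 //; lra.
move=> n p B ps pB.
have B0 := l2le_ge0 pB.
pose N := (c * n.+1)%N.
have := l2leM_euler hG pB.
have -> : g * (1 - fps_poly p * a) = g - fps_poly (p * Q).
  rewrite aE fps_polyM.
  have -> : g * (1 - fps_poly p * (fps_poly Q * h)) =
    g - fps_poly p * fps_poly Q * (g * h) by ring.
  by rewrite gh mulr1.
set psi : fps R[i] := g - _ => hpsi.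
have psiw : \sum_(k < N) dil w psi k = \sum_(k < N) dil w g k.
  have sz : (size (p * Q)%R <= N)%N.
    apply: leq_trans (size_polyMleq _ _) _; rewrite -subn1.
    apply: leq_trans (leq_sub2r 1 (leq_add ps (leqnn _))) _; rewrite /N /c -/Q.
    by move: (size Q) => t; lia.
  rewrite /psi; under eq_bigr => k _ do rewrite dilD dilN fpsBE.
  rewrite sumrB; suff -> : \sum_(k < N) dil w (fps_poly (p * Q)) k = 0 by rewrite subr0.
  by rewrite -(horner_coef_wide w sz) hornerM Qw mulr0.
have low : normc y / 2 <= normc (\sum_(k < N) dil w psi k).
  have MN : (M <= N)%N by rewrite /N /c; move: (size Q) => t; lia.
  have := hM N MN; rewrite psiw normcB.
  have := normc_le_sub y (\sum_(k < N) dil w g k); lra.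
have up : normc (\sum_(k < N) dil w psi k) ^+ 2 <= K N * ((G + 1) ^+ 2 * B).
  (* Written so that Cauchy-Schwarz with weights s^-2 yields K N times the squared weighted norm. *)
  apply: (@le_trans _ _ ((\sum_(k < N) s k ^- 2 * (s k ^+ 2 * normc (psi k))) ^+ 2)).
    apply: lerXn2r; rewrite ?nnegrE ?normc_ge0 //.
      by apply: sumr_ge0 => k _; rewrite !mulr_ge0 ?normc_ge0 ?sqr_ge0 ?invr_ge0 ?sqr_ge0.
    apply: le_trans (normc_sum _ _ _) _; apply: ler_sum => k _.
    rewrite normcM normcX w1 expr1n mulr1 mulrA mulVf ?mul1r //.
    by rewrite expf_neq0 // lt0r_neq0 // weight_gt0.
  apply: le_trans (weighted_cauchy_schwarz N
    (fun k => s k ^+ 2 * normc (psi k)) inv_sqr_weight_ge0) _.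
  apply: ler_wpM2l; first by apply: sumr_ge0 => k _; apply: inv_sqr_weight_ge0.
  apply: le_trans (le_trans (hpsi N) _).
    apply: ler_sum => k _; apply/eq_ler; have := weight_gt0 k => s0.
    by field; rewrite lt0r_neq0.
  by apply: ler_wpM2r => //; apply: lerXn2r; rewrite ?nnegrE; lra.
have Kn : 0 < K n.+1 by apply: lt_le_trans ltr01 (inv_sqr_sum_ge1 _).
have KN : K N <= c%:R * K n.+1 by apply: inv_sqr_sum_mul.
have GB0 : 0 <= (G + 1) ^+ 2 * B by rewrite mulr_ge0 ?sqr_ge0.
rewrite -mulrA -invfM ler_pdivrMr; last by rewrite !mulr_gt0 ?exprn_gt0 //; lra.
apply: (@le_trans _ _ (normc (\sum_(k < N) dil w psi k) ^+ 2)).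
  by apply: lerXn2r; rewrite ?nnegrE ?normc_ge0 // divr_ge0 ?normc_ge0.
apply: le_trans up _; apply: le_trans (ler_wpM2r GB0 KN) _.
apply/eq_ler; ring.
Qed.

End WeightedSequences.

(** * The power weights, and comparison of their inverse-square sums with [varphi] *)

Section PowerWeight.
Variable R : realType.
Implicit Types b x y : R.

(** The exponent is halved because [l2le] and [inv_sqr_sum] square the weight. *)
Definition pow_weight b k : R := k.+1%:R `^ (b / 2).

(** A ratio t <= 1 satisfies t <= t^p; adding two such bounds over a common y gives subadditivity of
    the power. *)
Lemma le_powR_id x y p : 0 < x -> x <= y -> 0 <= p <= 1 -> x / y * y `^ p <= x `^ p.
Proof.
move=> x0 xy /andP[p0 p1]; have y0 := lt_le_trans x0 xy.
have -> : x `^ p = (x / y) `^ p * y `^ p.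
  by rewrite -powRM ?divr_ge0 ?ltW // divfK // lt0r_neq0.
apply: ler_wpM2r; first exact: powR_ge0.
by apply: ger1_powR => //; rewrite divr_gt0 //= ler_pdivrMr // mul1r.
Qed.

Lemma powR_subadditive x y p : 0 < x -> 0 < y -> 0 <= p <= 1 ->
  (x + y) `^ p <= x `^ p + y `^ p.
Proof.
move=> x0 y0 p01.
apply: le_trans (lerD (le_powR_id x0 (_ : x <= x + y) p01)
  (le_powR_id y0 (_ : y <= x + y) p01)).
- by rewrite -!mulrDl divff ?mul1r // lt0r_neq0 // addr_gt0.
- by rewrite lerDl ltW.
- by rewrite lerDr ltW.
Qed.

Lemma pow_weightP b : 0 <= b <= 1 -> weight (pow_weight b).
Proof.
move=> b01; have p01 : 0 <= b / 2 <= 1 by lra.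
have [p0 p1] := andP p01.
have n0 k : 0 < k.+1%:R :> R by rewrite ltr0n.
have mono x y : 0 <= x -> x <= y -> x `^ (b / 2) <= y `^ (b / 2).
  by move=> x0 xy; apply: ge0_ler_powR => //; rewrite nnegrE // (le_trans x0).
split; rewrite /pow_weight.
- by rewrite powR1.
- by move=> i j ij; apply: mono; rewrite ?ler0n // ler_nat ltnS.
- move=> i j; apply: le_trans (powR_subadditive (n0 i) (n0 j) p01).
  by apply: mono; rewrite ?ler0n // -natrD ler_nat; lia.
move=> i j; apply: (@le_trans _ _ ((i.+1%:R * j.+1%:R) `^ (b / 2))).
  by apply: mono; rewrite ?ler0n // -natrM ler_nat; lia.
rewrite powRM ?ler0n //; apply: ler_wpM2r; first exact: powR_ge0.
by apply: ler1_powR => //; rewrite ler1n.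
Qed.

Lemma pow_weight_sqr b k : pow_weight b k ^+ 2 = k.+1%:R `^ b.
Proof.
rewrite /pow_weight -powR_mulrn ?powR_ge0 // -powRrM; congr (_ `^ _).
by rewrite divfK.
Qed.

Lemma inv_sqr_sum_powE b m :
  inv_sqr_sum (pow_weight b) m = \sum_(k < m) (k.+1%:R `^ b)^-1.
Proof. by apply: eq_bigr => k _; rewrite pow_weight_sqr. Qed.

(** Young's inequality for the product of x^p and 1, with exponents 1/p and 1/(1 - p). *)
Lemma powR_le_tangent x p : 0 <= x -> 0 < p < 1 -> x `^ p <= p * x + (1 - p).
Proof.
move=> x0 /andP[p0 p1].
have q0 : 0 < 1 - p by rewrite subr_gt0.
have := @conjugate_powR R (x `^ p) 1 p^-1 (1 - p)^-1 (powR_ge0 _ _) ler01.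
rewrite !invr_gt0 !invrK addrCA subrr addr0 => /(_ p0 q0 erefl).
by rewrite mulr1 powR1 -powRrM divff ?lt0r_neq0 // powRr1 // mul1r mulrC.
Qed.

(** At b = 1 the two agree. For b < 1, every term is at least the last one, which gives the first
    bound; the second is an induction on (1 - b) y^-b <= y^(1-b) - (y - 1)^(1-b), the tangent bound
    at (y - 1)/y. *)
Lemma inv_sqr_sum_varphi b : 0 <= b <= 1 -> exists c : R, [/\ 0 < c,
  forall n, varphi b n.+1 <= inv_sqr_sum (pow_weight b) n.+1 &
  forall n, inv_sqr_sum (pow_weight b) n.+1 <= c * varphi b n.+1].
Proof.
move=> /andP[b0 b1]; rewrite /varphi; have [->|bn1] := eqVneq b 1.
  have e n : \sum_(1 <= j < n.+2) j%:R^-1 = inv_sqr_sum (pow_weight 1) n.+1 :> R.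
    rewrite inv_sqr_sum_powE big_add1 /= big_mkord.
    by apply: eq_bigr => k _; rewrite powRr1.
  by exists 1; split => // n; rewrite e ?mul1r.
have d0 : 0 < 1 - b by rewrite subr_gt0 lt_neqAle bn1.
have sumE n : n.+1%:R `^ (1 - b) = n.+1%:R * (n.+1%:R `^ b)^-1 :> R.
  by rewrite powRB ?pnatr_eq0 ?implybT // powRr1.
have pos n : 0 < n.+1%:R `^ b :> R by apply: powR_gt0; rewrite ltr0n.
exists (1 - b)^-1; split; first by rewrite invr_gt0.
  move=> n; rewrite sumE inv_sqr_sum_powE.
  have -> : n.+1%:R / n.+1%:R `^ b = \sum_(k < n.+1) (n.+1%:R `^ b)^-1 :> R.
    by rewrite sumr_const card_ord mulr_natl.
  apply: ler_sum => k _; rewrite lef_pV2 ?posrE //.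
  by apply: ge0_ler_powR; rewrite ?nnegrE ?ler0n ?ler_nat ?ltn_ord.
move=> n; rewrite inv_sqr_sum_powE mulrC ler_pdivlMr //.
elim: n => [|n IH]; first by rewrite big_ord_recl big_ord0 !powR1 invr1; lra.
rewrite big_ord_recr /= mulrDl; apply: le_trans (lerD IH (lexx _)) _.
set x : R := n.+1%:R; set y : R := n.+2%:R.
have yx : y = x + 1 by rewrite /x /y -natr1.
have x0 : 0 < x by rewrite ltr0n.
have y0 : 0 < y by rewrite ltr0n.
have e : (y `^ b)^-1 = y `^ (1 - b) / y.
  by rewrite /y sumE mulrAC divff ?mul1r // pnatr_eq0.
have -> : x `^ (1 - b) = (x / y) `^ (1 - b) * y `^ (1 - b).
  by rewrite -powRM ?divr_ge0 ?ltW // divfK // lt0r_neq0.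
have : (x / y) `^ (1 - b) <= (1 - b) * (x / y) + b.
  have xy0 : 0 <= x / y by rewrite divr_ge0 // ltW.
  have [->|bn0] := eqVneq b 0; first by rewrite !subr0 powRr1 // mul1r addr0.
  have bp : 0 < b by rewrite lt_neqAle eq_sym bn0.
  by have := powR_le_tangent xy0 (_ : 0 < 1 - b < 1); rewrite subKr; apply; lra.
rewrite e; have := powR_gt0 (1 - b) y0; move: (y `^ _) ((x / y) `^ _) => Y t Y0 ht.
have -> : Y / y * (1 - b) = (1 - b) * (1 - x / y) * Y.
  have -> : x = y - 1 by rewrite yx addrK.
  by field; rewrite lt0r_neq0.
by rewrite -mulrDl -[leRHS]mul1r; apply: ler_wpM2r;
  [exact: ltW|by move: (x / y) ht => z ht; lra].
Qed.

End PowerWeight.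

(** * Rectangular partial sums of double series *)

Definition rect_sum (V : nmodType) (x : nat -> nat -> V) M N : V :=
  \sum_(k < M) \sum_(l < N) x k l.

(** The coefficients after multiplication by z1^i z2^j. *)
Definition shift2 (V : nmodType) i j (x : nat -> nat -> V) : nat -> nat -> V :=
  fun k l => if (i <= k)%N && (j <= l)%N then x (k - i)%N (l - j)%N else 0.

Lemma rect_sum_shift2 (V : nmodType) i j (x : nat -> nat -> V) M N :
  rect_sum (shift2 i j x) (i + M) (j + N) = rect_sum x M N.
Proof.
rewrite /rect_sum big_split_ord /= big1 ?add0r; last first.
  by move=> k _; apply: big1 => l _; rewrite /shift2 leqNgt ltn_ord.
apply: eq_bigr => k _; rewrite big_split_ord /= big1 ?add0r; last first.
  by move=> l _; rewrite /shift2 [(j <= l)%N]leqNgt ltn_ord andbF.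
by apply: eq_bigr => l _; rewrite /shift2 !leq_addr /= !addKn.
Qed.

Section DoubleSums.
Variable R : realType.
Implicit Types (x y : nat -> nat -> R) (c d : nat -> nat -> R[i]).

Lemma rect_sum_widen (V : nmodType) (x : nat -> nat -> V) M N P :
  (M <= P)%N -> (N <= P)%N -> rect_sum x M N =
  \sum_(k < P) \sum_(l < P) if (k < M)%N && (l < N)%N then x k l else 0.
Proof.
move=> MP NP; rewrite /rect_sum (big_ord_widen P (fun k => \sum_(l < N) x k l)) //.
rewrite big_mkcond /=; apply: eq_bigr => k _; case: ifP => kM; last by rewrite big1.
by rewrite (big_ord_widen P (x k)) // big_mkcond.
Qed.

Lemma rect_sum_le x y M N : (forall k l, x k l <= y k l) ->
  rect_sum x M N <= rect_sum y M N.
Proof. by move=> xy; do 2!apply: ler_sum => ? _. Qed.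

Lemma rect_sum_homo x M N M' N' : (forall k l, 0 <= x k l) -> (M <= M')%N ->
  (N <= N')%N -> rect_sum x M N <= rect_sum x M' N'.
Proof.
move=> x0 hM hN; pose P := maxn M' N'.
have [h1 h2] : (M' <= P)%N /\ (N' <= P)%N by rewrite leq_maxl leq_maxr.
rewrite (rect_sum_widen x (leq_trans hM h1) (leq_trans hN h2)) (rect_sum_widen x h1 h2).
do 2!apply: ler_sum => ? _; case: ifP => [/andP[h3 h4]|_]; last by case: ifP.
by rewrite (leq_trans h3 hM) (leq_trans h4 hN).
Qed.

Lemma rect_sum_cauchy x T : (forall k l, 0 <= x k l) -> (forall N, rect_sum x N N <= T) ->
  forall e, 0 < e -> exists N, forall n, (N <= n)%N -> rect_sum x n n - rect_sum x N N < e.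
Proof.
move=> x0; apply: nondecreasing_bounded_cauchy => m n mn.
exact: rect_sum_homo.
Qed.

(** The terms in the difference lie in the square of side [P] and outside that of side [Q]. *)
Lemma rect_sum_sub_le c M N P Q : (Q <= M)%N -> (Q <= N)%N -> (M <= P)%N -> (N <= P)%N ->
  normc (rect_sum c M N - rect_sum c Q Q)
  <= rect_sum (fun k l => normc (c k l)) P P - rect_sum (fun k l => normc (c k l)) Q Q.
Proof.
move=> QM QN MP NP; have QP := leq_trans QM MP.
rewrite (rect_sum_widen c MP NP) (rect_sum_widen c QP QP).
rewrite (rect_sum_widen _ (leqnn P) (leqnn P)).
rewrite (rect_sum_widen (fun k l => normc (c k l)) QP QP).
rewrite -!sumrB; apply: le_trans (normc_sum _ _ _) _; apply: ler_sum => k _.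
rewrite -!sumrB; apply: le_trans (normc_sum _ _ _) _; apply: ler_sum => l _.
rewrite !ltn_ord /=.
have [kQ|Qk] := ltnP k Q; have [lQ|Ql] := ltnP l Q => /=.
- by rewrite (leq_trans kQ QM) (leq_trans lQ QN) !subrr normc0.
- by case: ifP => _; rewrite !subr0 ?normc0 ?normc_ge0.
- by case: ifP => _; rewrite !subr0 ?normc0 ?normc_ge0.
- by case: ifP => _; rewrite !subr0 ?normc0 ?normc_ge0.
Qed.

(* For an absolutely convergent double series, squares may be traded for any
   rectangles containing them. *)
Lemma cvgc_rect_square c s (m m' : nat -> nat) T :
    (forall N, rect_sum (fun k l => normc (c k l)) N N <= T) ->
    (forall N, (N <= m N)%N && (N <= m' N)%N) ->
    cvgc (fun N => rect_sum c (m N) (m' N)) s ->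
  cvgc (fun N => rect_sum c N N) s.
Proof.
move=> hT hm hs e e0; have e2 : 0 < e / 2 by lra.
have [N hN] := hs _ e2.
have [N' hN'] := rect_sum_cauchy (fun k l => normc_ge0 (c k l)) hT e2.
exists (maxn N N') => n; rewrite geq_max => /andP[/hN h1 N'n].
have /andP[mn mn'] := hm n.
have := rect_sum_sub_le c mn mn' (leq_maxl (m n) (m' n)) (leq_maxr (m n) (m' n)).
have := hN' (maxn (m n) (m' n)) (leq_trans N'n (leq_trans mn (leq_maxl _ _))).
have := rect_sum_homo (fun k l => normc_ge0 (c k l)) N'n N'n.
move=> h2 h3 h4.
have -> : rect_sum c n n - s = (rect_sum c (m n) (m' n) - s) -
  (rect_sum c (m n) (m' n) - rect_sum c n n) by ring.
by apply: le_lt_trans (le_normcB _ _) _; lra.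
Qed.

(** Replaces the nested extended-real series of the norms by finite square sums, on which all later
    estimates are done. *)
Lemma nested_nneseries_le x T : (forall k l, 0 <= x k l) ->
  (\sum_(0 <= k <oo) \sum_(0 <= l <oo) (x k l)%:E <= T%:E)%E <->
  forall N, rect_sum x N N <= T.
Proof.
move=> x0; have x0' k l : (0 <= (x k l)%:E)%E by rewrite lee_fin.
split=> [h N|h].
  rewrite -lee_fin; apply: le_trans h.
  apply: le_trans (nneseries_lim_ge N _); last first.
    by move=> k _ _; apply: nneseries_ge0.
  rewrite /rect_sum -(big_mkord xpredT (fun k => \sum_(l < N) x k l)).
  rewrite -sumEFin; apply: lee_sum => k _.
  rewrite -(big_mkord xpredT (x k)) -sumEFin.
  by apply: nneseries_lim_ge.
apply: lime_le; first by apply: is_cvg_nneseries => k _ _; apply: nneseries_ge0.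
apply: nearW => N; rewrite -(nneseries_sum_nat 0 N 0 x0').
apply: lime_le; first by apply: is_cvg_nneseries => k _ _; apply: sume_ge0.
apply: nearW => M.
under eq_bigr => l _ do rewrite sumEFin.
rewrite sumEFin lee_fin exchange_big /= !big_mkord.
under eq_bigr => l _ do rewrite big_mkord.
apply: le_trans (h (maxn N M)).
by apply: rect_sum_homo; rewrite ?leq_maxl ?leq_maxr.
Qed.

Lemma nested_nneseries_lty x : (forall k l, 0 <= x k l) ->
  (\sum_(0 <= k <oo) \sum_(0 <= l <oo) (x k l)%:E < +oo)%E <->
  exists T, forall N, rect_sum x N N <= T.
Proof.
move=> x0; split=> [|[T /(nested_nneseries_le T x0) h]]; last exact: le_lt_trans (ltry T).
set S := (\sum_(0 <= k <oo) _)%E => h.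
have S0 : (0 <= S)%E.
  by apply: nneseries_ge0 => k _ _; apply: nneseries_ge0 => l _ _; rewrite lee_fin.
exists (fine S); apply/(nested_nneseries_le _ x0); rewrite -/S fineK //.
by rewrite ge0_fin_numE.
Qed.

End DoubleSums.

(** * Taylor series on the ball and uniqueness of their coefficients *)

Section BallSeries.
Variable R : realType.
Implicit Types (a b : nat -> nat -> R[i]) (F G : R[i] * R[i] -> R[i]) (p : R[i] * R[i]).

Definition ball_term a p k l : R[i] := a k l * p.1 ^+ k * p.2 ^+ l.

Lemma taylor_on_ballP a F : taylor_on_ball a F <->
  forall p, unit_ball2 p ->
    (exists T, forall N, rect_sum (fun k l => normc (ball_term a p k l)) N N <= T) /\
    cvgc (fun N => rect_sum (ball_term a p) N N) (F p).
Proof.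
have P p := @nested_nneseries_lty R (fun k l => normc (ball_term a p k l))
  (fun k l => normc_ge0 _).
split=> h p pb; have [h1 h2] := h p pb.
  by split; [apply/P|apply/cvgcP].
by split; [apply/P|apply/cvgcP].
Qed.

Lemma taylor_on_ballD a b F G : taylor_on_ball a F -> taylor_on_ball b G ->
  taylor_on_ball (fun k l => a k l + b k l) (fun p => F p + G p).
Proof.
move=> /taylor_on_ballP ha /taylor_on_ballP hb; apply/taylor_on_ballP => p pb.
have [[S hS] hF] := ha p pb; have [[T hT] hG] := hb p pb; split.
  exists (S + T) => N; apply: le_trans (lerD (hS N) (hT N)).
  rewrite -big_split; apply: ler_sum => k _; rewrite -big_split; apply: ler_sum => l _ /=.
  by rewrite /ball_term !mulrDl; apply: le_normcD.
have -> : (fun N => rect_sum (ball_term (fun k l => a k l + b k l) p) N N) =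
   (fun N => rect_sum (ball_term a p) N N + rect_sum (ball_term b p) N N).
  apply/funext => N; rewrite -big_split; apply: eq_bigr => k _; rewrite -big_split.
  by apply: eq_bigr => l _; rewrite /ball_term !mulrDl.
exact: cvgcD.
Qed.

Lemma taylor_on_ballZ (c : R[i]) a F : taylor_on_ball a F ->
  taylor_on_ball (fun k l => c * a k l) (fun p => c * F p).
Proof.
move=> /taylor_on_ballP ha; apply/taylor_on_ballP => p pb.
have [[S hS] hF] := ha p pb; split.
  exists (normc c * S) => N; apply: le_trans (ler_wpM2l (normc_ge0 c) (hS N)).
  rewrite mulr_sumr; apply: ler_sum => k _; rewrite mulr_sumr; apply: ler_sum => l _ /=.
  by rewrite /ball_term -!mulrA normcM.
have -> : (fun N => rect_sum (ball_term (fun k l => c * a k l) p) N N) =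
   (fun N => c * rect_sum (ball_term a p) N N).
  apply/funext => N; rewrite mulr_sumr; apply: eq_bigr => k _; rewrite mulr_sumr.
  by apply: eq_bigr => l _; rewrite /ball_term -!mulrA.
exact: cvgcZ.
Qed.

Lemma taylor_on_ballB a b F G : taylor_on_ball a F -> taylor_on_ball b G ->
  taylor_on_ball (fun k l => a k l - b k l) (fun p => F p - G p).
Proof.
move=> ha /(taylor_on_ballZ (-1)) hb; have := taylor_on_ballD ha hb.
have -> : (fun k l => a k l + -1 * b k l) = (fun k l => a k l - b k l).
  by apply/funext => k; apply/funext => l; rewrite mulN1r.
by have -> : (fun p => F p + -1 * G p) = (fun p => F p - G p)
  by apply/funext => p; rewrite mulN1r.
Qed.

Lemma taylor_on_ball_zero : taylor_on_ball (fun _ _ => 0) (fun=> (0 : R[i])).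
Proof.
have z p : ball_term (fun _ _ => 0) p = fun _ _ => 0.
  by apply/funext => k; apply/funext => l; rewrite /ball_term !mul0r.
apply/taylor_on_ballP => p _; rewrite z; split.
  by exists 0 => N; rewrite /rect_sum big1 // => k _; rewrite big1 // => l _; rewrite normc0.
have -> : (fun N => rect_sum (fun _ _ => (0 : R[i])) N N) = fun=> 0.
  by apply/funext => N; rewrite /rect_sum big1 // => k _; rewrite big1.
exact: cvgc_cst.
Qed.

Lemma taylor_on_ball_sum (I : Type) (r : seq I) (P : pred I)
    (a : I -> nat -> nat -> R[i]) (F : I -> R[i] * R[i] -> R[i]) :
  (forall i, P i -> taylor_on_ball (a i) (F i)) ->
  taylor_on_ball (fun k l => \sum_(i <- r | P i) a i k l)
    (fun p => \sum_(i <- r | P i) F i p).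
Proof.
move=> h; elim: r => [|i r IH].
  have -> : (fun k l => \sum_(i <- [::] | P i) a i k l) = (fun _ _ => 0).
    by apply/funext => k; apply/funext => l; rewrite big_nil.
  have -> : (fun p => \sum_(i <- [::] | P i) F i p) = (fun=> 0).
    by apply/funext => p; rewrite big_nil.
  exact: taylor_on_ball_zero.
have -> : (fun k l => \sum_(j <- i :: r | P j) a j k l) =
    (fun k l => (if P i then a i k l else 0) + \sum_(j <- r | P j) a j k l).
  apply/funext => k; apply/funext => l; rewrite big_cons; case: ifP => //.
  by rewrite add0r.
have -> : (fun p => \sum_(j <- i :: r | P j) F j p) =
    (fun p => (if P i then F i p else 0) + \sum_(j <- r | P j) F j p).
  by apply/funext => p; rewrite big_cons; case: ifP => //; rewrite add0r.
case Pi : (P i); first exact: (taylor_on_ballD (h i Pi) IH).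
have -> : (fun k l => 0 + \sum_(j <- r | P j) a j k l) =
    (fun k l => \sum_(j <- r | P j) a j k l).
  by apply/funext => k; apply/funext => l; rewrite add0r.
by have -> : (fun p => 0 + \sum_(j <- r | P j) F j p) =
    (fun p => \sum_(j <- r | P j) F j p) by apply/funext => p; rewrite add0r.
Qed.

Lemma taylor_on_ball_shift2 i j a F : taylor_on_ball a F ->
  taylor_on_ball (shift2 i j a) (fun p => p.1 ^+ i * p.2 ^+ j * F p).
Proof.
move=> /taylor_on_ballP ha; apply/taylor_on_ballP => p pb.
have [[S hS] hF] := ha p pb; pose q := p.1 ^+ i * p.2 ^+ j.
have e : ball_term (shift2 i j a) p = shift2 i j (fun k l => q * ball_term a p k l).
  apply/funext => k; apply/funext => l; rewrite /ball_term /shift2.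
  case: ifP => [/andP[ik jl]|_]; last by rewrite !mul0r.
  have -> : p.1 ^+ k = p.1 ^+ i * p.1 ^+ (k - i) by rewrite -exprD subnKC.
  have -> : p.2 ^+ l = p.2 ^+ j * p.2 ^+ (l - j) by rewrite -exprD subnKC.
  by rewrite /q; ring.
have hn : (fun k l => normc (ball_term (shift2 i j a) p k l)) =
    shift2 i j (fun k l => normc q * normc (ball_term a p k l)).
  apply/funext => k; apply/funext => l; rewrite e /shift2.
  by case: ifP => _; rewrite ?normc0 // normcM.
have hT N : rect_sum (fun k l => normc (ball_term (shift2 i j a) p k l)) N N <= normc q * S.
  apply: le_trans (rect_sum_homo (fun k l => normc_ge0 _) (leq_addl i N) (leq_addl j N)) _.
  rewrite hn rect_sum_shift2; apply: le_trans (ler_wpM2l (normc_ge0 q) (hS N)).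
  by rewrite mulr_sumr; apply: ler_sum => k _; rewrite mulr_sumr.
split; first by exists (normc q * S).
(* The shift turns squares into rectangles of sides i + N and j + N, on which the partial sums are
   exactly multiples of the old ones. *)
apply: (cvgc_rect_square (m := fun N => (i + N)%N) (m' := fun N => (j + N)%N) hT) => [N|].
  by rewrite !leq_addl.
have -> : (fun N => rect_sum (ball_term (shift2 i j a) p) (i + N) (j + N)) =
    (fun N => q * rect_sum (ball_term a p) N N).
  apply/funext => N; rewrite e rect_sum_shift2 /rect_sum mulr_sumr.
  by apply: eq_bigr => k _; rewrite mulr_sumr.
exact: cvgcZ.
Qed.

Definition E1_coef (d : nat -> R[i]) k l : R[i] := if l == 0%N then d k else 0.

Lemma taylor_on_ball_E1 (d : fps R[i]) (f : R[i] -> R[i]) : l1 d ->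
  (forall z, normc z < 1 -> sum_to (dil z d) (f z)) ->
  taylor_on_ball (E1_coef d) (E1 f).
Proof.
move=> [A hA] hd; apply/taylor_on_ballP => p pb.
have p1 : normc p.1 < 1.
  move: pb; rewrite /unit_ball2 /= => pb; rewrite -(expr_lt1 (n := 2)) ?normc_ge0 //.
  by have := sqr_ge0 (normc p.2); lra.
have e (V : nmodType) (g : nat -> V) N :
    rect_sum (fun k l => if l == 0%N then g k else 0) N N = \sum_(k < N) g k.
  case: N => [|N]; first by rewrite /rect_sum !big_ord0.
  apply: eq_bigr => k _; rewrite big_ord_recl /= big1 ?addr0 //.
have te : ball_term (E1_coef d) p = fun k l => if l == 0%N then dil p.1 d k else 0.
  apply/funext => k; apply/funext => -[|l]; rewrite /ball_term /E1_coef /= ?expr0 ?mulr1 //.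
  by rewrite !mul0r.
split.
  exists A => N; rewrite te.
  have -> : (fun k l => normc (if l == 0%N then dil p.1 d k else 0)) =
     fun k l => if l == 0%N then normc (dil p.1 d k) else 0.
    by apply/funext => k; apply/funext => l; case: ifP => // _; rewrite normc0.
  by rewrite e; apply: l1le_dil => //; apply: ltW.
by rewrite te; under eq_fun => N do rewrite e; apply: hd.
Qed.

(** The torus of radii 1/2 lies in the ball, as 1/4 + 1/4 < 1; the Cauchy estimates are taken on
    it. *)
Lemma unit_ball2_half (z w : R[i]) : normc z = 1 -> normc w = 1 ->
  unit_ball2 (z / 2, w / 2).
Proof.
move=> z1 w1; rewrite /unit_ball2 /= !normcM z1 w1 !mul1r.
have -> : normc (2^-1 : R[i]) = 2^-1.
  have -> : (2 : R[i]) = 2%:C by rewrite rmorph_nat.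
  by rewrite normcV normc_real ger0_norm.
by rewrite expr2; lra.
Qed.

(** A large square section is uniformly small on the torus, and the one-variable coefficient
    estimate is applied in each variable in turn. *)
Lemma taylor_on_ball0 a : taylor_on_ball a (fun=> 0) -> forall k l, a k l = 0.
Proof.
move=> /taylor_on_ballP ha k0 l0.
pose x k l := a k l * 2^-1 ^+ k * 2^-1 ^+ l.
have xE z w : ball_term a (z / 2, w / 2) = fun k l => x k l * z ^+ k * w ^+ l.
  by apply/funext => k; apply/funext => l; rewrite /ball_term /x !exprMn /=; ring.
have nx (z w : R[i]) k l : normc z = 1 -> normc w = 1 ->
    normc (x k l * z ^+ k * w ^+ l) = normc (x k l).
  by move=> z1 w1; rewrite !normcM !normcX z1 w1 !expr1n !mulr1.
have [[T hT] _] := ha _ (unit_ball2_half (normc1 R) (normc1 R)).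
have {}hT N : rect_sum (fun k l => normc (x k l)) N N <= T.
  apply: le_trans (hT N); rewrite xE; apply: rect_sum_le => k l.
  exact: (eq_ler (esym (nx 1 1 k l (normc1 R) (normc1 R)))).
suff x0 : x k0 l0 = 0.
  move/eqP: x0; rewrite /x -mulrA mulf_eq0 => /orP[/eqP //|].
  by rewrite mulf_eq0 !expf_eq0 invr_eq0 pnatr_eq0 /= !andbF.
apply/eqP; rewrite -normc_eq0 eq_le normc_ge0 andbT.
apply/ler_addgt0Pl => e e0; rewrite addr0.
have [N hN] := rect_sum_cauchy (fun k l => normc_ge0 (x k l)) hT e0.
pose P := (maxn N (maxn k0 l0)).+1.
have small z w : normc z = 1 -> normc w = 1 ->
    normc (\sum_(k < P) (\sum_(l < P) x k l * w ^+ l) * z ^+ k) <= e.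
  move=> z1 w1; have [_ hc] := ha _ (unit_ball2_half z1 w1).
  have -> : \sum_(k < P) (\sum_(l < P) x k l * w ^+ l) * z ^+ k =
      rect_sum (ball_term a (z / 2, w / 2)) P P.
    rewrite xE; apply: eq_bigr => k _; rewrite mulr_suml; apply: eq_bigr => l _.
    by rewrite mulrAC.
  set S := rect_sum _ P P.
  have hS := cvgcD hc (cvgc_cst (- S)); rewrite sub0r in hS.
  rewrite -normcN; apply: (cvgc_le (k := P) hS) => n Pn.
  apply: le_trans (rect_sum_sub_le _ Pn Pn (leqnn n) (leqnn n)) _.
  have NP : (N <= P)%N by rewrite /P; lia.
  have h1 := hN n (leq_trans NP Pn).
  have h2 := rect_sum_homo (fun k l => normc_ge0 (x k l)) NP NP.
  have e1 M : rect_sum (fun k l => normc (ball_term a (z / 2, w / 2) k l)) M M =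
     rect_sum (fun k l => normc (x k l)) M M.
    by rewrite xE; do 2!apply: eq_bigr => ? _; rewrite nx.
  apply: le_trans (eq_ler (f_equal2 (fun u v => u - v) (e1 n) (e1 P))) _.
  move: h1 h2; move: (rect_sum _ n n) (rect_sum _ P P) (rect_sum _ N N) => t u v; lra.
have k0P : (k0 < P)%N by rewrite /P; lia.
have l0P : (l0 < P)%N by rewrite /P; lia.
apply: (cauchy_estimate_poly (c := x k0) l0P) => w w1.
by apply: (cauchy_estimate_poly (c := fun k => \sum_(l < P) x k l * w ^+ l) k0P)
  => z z1; apply: small.
Qed.

Lemma taylor_on_ball_uniq a b F : taylor_on_ball a F -> taylor_on_ball b F -> a = b.
Proof.
move=> ha hb; have := taylor_on_ballB ha hb.
have -> : (fun p => F p - F p) = fun=> 0 by apply/funext => p; rewrite subrr.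
move=> /taylor_on_ball0 h; apply/funext => k; apply/funext => l.
by apply/eqP; rewrite -subr_eq0 h.
Qed.

(** By uniqueness the chosen coefficients are the ones at hand, so norms can be computed from any
    known expansion. *)
Lemma ball_coefE a F : taylor_on_ball a F -> ball_coef F = a.
Proof.
move=> h; apply: (@taylor_on_ball_uniq _ _ F) => //.
exact: (@xgetPex _ (fun=> fun=> 0) [set a | taylor_on_ball a F] (ex_intro _ a h)).
Qed.

Definition ball_weight (alpha : R) k l : R :=
  (2 + k + l)%:R `^ alpha * ((k`! * l`!)%:R / ((1 + k + l)`!)%:R).

Definition dl2le alpha a (B : R) := forall N,
  rect_sum (fun k l => ball_weight alpha k l * normc (a k l) ^+ 2) N N <= B.

Lemma ball_weight_ge0 alpha k l : 0 <= ball_weight alpha k l.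
Proof. by rewrite mulr_ge0 ?powR_ge0 // divr_ge0. Qed.

Lemma ball_weight_sqr_ge0 alpha a k l : 0 <= ball_weight alpha k l * normc (a k l) ^+ 2.
Proof. by rewrite mulr_ge0 ?ball_weight_ge0 ?sqr_ge0. Qed.

Lemma sqnorm2_le alpha a F B : taylor_on_ball a F ->
  (sqnorm2 alpha F <= B%:E)%E <-> dl2le alpha a B.
Proof.
move=> h; rewrite /sqnorm2 (ball_coefE h).
by apply: nested_nneseries_le => k l; apply: ball_weight_sqr_ge0.
Qed.

Lemma sqnorm2_lty alpha a F : taylor_on_ball a F ->
  (sqnorm2 alpha F < +oo)%E <-> exists B, dl2le alpha a B.
Proof.
move=> h; rewrite /sqnorm2 (ball_coefE h).
by apply: nested_nneseries_lty => k l; apply: ball_weight_sqr_ge0.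
Qed.

Lemma sqnorm2_ge0 alpha F : (0 <= sqnorm2 alpha F)%E.
Proof.
apply: nneseries_ge0 => k _ _; apply: nneseries_ge0 => l _ _.
by rewrite lee_fin ball_weight_sqr_ge0.
Qed.

End BallSeries.

(** * The weights of the bivariate norm: comparison with one variable, and bounded shifts *)

Section BallWeights.
Variable R : realType.
Implicit Types (alpha B : R) (a b : nat -> nat -> R[i]) (d : fps R[i]).

Lemma ball_weight_le alpha beta k l : alpha <= beta ->
  ball_weight alpha k l <= ball_weight beta k l.
Proof.
move=> ab; apply: ler_wpM2r; first by rewrite divr_ge0.
by apply: ler_powR => //; rewrite ler1n.
Qed.

Lemma ball_weight0E alpha k :
  ball_weight alpha k 0 = k.+2%:R `^ alpha / k.+1%:R.
Proof.
rewrite /ball_weight !addn0 add2n add1n fact0 muln1; congr (_ * _).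
have f0 : (k`!)%:R != 0 :> R by rewrite pnatr_eq0 -lt0n fact_gt0.
have k0 : k.+1%:R != 0 :> R by rewrite pnatr_eq0.
by rewrite factS natrM; move: (k`!%:R) k.+1%:R f0 k0 => x y x0 y0; field; rewrite x0 y0.
Qed.

(** The weight is (k+2)^alpha / (k+1). From k+2 <= 2 (k+1), one factor 2 comes from (k+2)/(k+1) and
    one from the power alpha - 1 <= 1. *)
Lemma ball_weight0_bounds alpha k : 1 <= alpha <= 2 ->
  k.+1%:R `^ (alpha - 1) <= ball_weight alpha k 0 <= 4 * k.+1%:R `^ (alpha - 1).
Proof.
move=> /andP[a1 a2]; rewrite ball_weight0E; set b := alpha - 1.
have b01 : 0 <= b <= 1 by rewrite /b; lra.
have x0 : 0 < k.+1%:R :> R by rewrite ltr0n.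
have y0 : 0 < k.+2%:R :> R by rewrite ltr0n.
have y2 : k.+2%:R <= 2 * k.+1%:R :> R by rewrite -natrM ler_nat; lia.
have xy : k.+1%:R <= k.+2%:R :> R by rewrite ler_nat.
have -> : k.+2%:R `^ alpha = k.+2%:R * k.+2%:R `^ b.
  by rewrite mulr_powRB1 ?ltW //; lra.
have [b0 b1] := andP b01.
have lo : k.+1%:R `^ b <= k.+2%:R `^ b by apply: ge0_ler_powR; rewrite ?nnegrE ?ler0n.
have up : k.+2%:R `^ b <= 2 * k.+1%:R `^ b.
  apply: (@le_trans _ _ ((2 * k.+1%:R) `^ b)).
    by apply: ge0_ler_powR; rewrite ?nnegrE // mulr_ge0 // ltW.
  rewrite powRM ?ler0n //; apply: ler_wpM2r; first exact: powR_ge0.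
  by apply: ler1_powR => //; lra.
have Y0 : 0 <= k.+1%:R `^ b := powR_ge0 _ _.
apply/andP; split; first by rewrite ler_pdivlMr // mulrC; apply: ler_pM.
rewrite ler_pdivrMr //.
have -> : 4 * k.+1%:R `^ b * k.+1%:R = 2 * k.+1%:R * (2 * k.+1%:R `^ b) by ring.
exact: ler_pM.
Qed.

Lemma rect_sum_E1_coef alpha d N :
  rect_sum (fun k l => ball_weight alpha k l * normc (E1_coef d k l) ^+ 2) N N =
  \sum_(k < N) ball_weight alpha k 0 * normc (d k) ^+ 2.
Proof.
case: N => [|N]; first by rewrite /rect_sum !big_ord0.
apply: eq_bigr => k _; rewrite big_ord_recl [X in _ + X]big1 ?addr0 // => l _.
by rewrite [normc _](normc0 R) expr0n mulr0.
Qed.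

Lemma dl2le_E1 alpha d B : 1 <= alpha <= 2 ->
  l2le (pow_weight (alpha - 1)) d B -> dl2le alpha (E1_coef d) (4 * B).
Proof.
move=> a12 h N; rewrite rect_sum_E1_coef; apply: le_trans (ler_wpM2l _ (h N)) => //.
rewrite mulr_sumr; apply: ler_sum => k _; rewrite exprMn pow_weight_sqr [leRHS]mulrA.
apply: ler_wpM2r; first exact: sqr_ge0.
by have /andP[] := ball_weight0_bounds k a12.
Qed.

Lemma l2le_column alpha b d B : 1 <= alpha <= 2 -> (forall k, b k 0%N = d k) ->
  dl2le alpha b B -> l2le (pow_weight (alpha - 1)) d B.
Proof.
move=> a12 bd h N; case: N => [|N].
  by rewrite big_ord0; apply: le_trans (h 0%N); rewrite /rect_sum big_ord0.
apply: le_trans (h N.+1); apply: ler_sum => k _.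
rewrite big_ord_recl; apply: ler_wpDr.
  by apply: sumr_ge0 => l _; apply: ball_weight_sqr_ge0.
rewrite exprMn pow_weight_sqr bd; apply: ler_wpM2r; first exact: sqr_ge0.
by have /andP[] := ball_weight0_bounds k a12.
Qed.

(** The bases 2 + k + l are at least 1. Approximation for the exponent 2 therefore serves every
    smaller one. *)
Lemma dl2le_exponent alpha beta a B : alpha <= beta -> dl2le beta a B -> dl2le alpha a B.
Proof.
move=> ab h N; apply: le_trans (h N); apply: rect_sum_le => k l.
by apply: ler_wpM2r (ball_weight_le _ _ ab); apply: sqr_ge0.
Qed.

Lemma dl2le_le alpha a B B' : B <= B' -> dl2le alpha a B -> dl2le alpha a B'.
Proof. by move=> BB h N; apply: le_trans BB. Qed.

Lemma dl2leD alpha a b A B : dl2le alpha a A -> dl2le alpha b B ->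
  dl2le alpha (fun k l => a k l + b k l) (2 * (A + B)).
Proof.
move=> ha hb N; apply: le_trans (ler_wpM2l _ (lerD (ha N) (hb N))) => //.
rewrite -big_split mulr_sumr; apply: ler_sum => k _ /=.
rewrite -big_split mulr_sumr; apply: ler_sum => l _ /=.
have := ler_wpM2l (ball_weight_ge0 alpha k l) (normcD_sqr (a k l) (b k l)).
by move/le_trans; apply; apply/eq_ler; ring.
Qed.

Lemma dl2leZ alpha (c : R[i]) a B : dl2le alpha a B ->
  dl2le alpha (fun k l => c * a k l) (normc c ^+ 2 * B).
Proof.
move=> h N; apply: le_trans (ler_wpM2l (sqr_ge0 _) (h N)).
rewrite mulr_sumr; apply: ler_sum => k _; rewrite mulr_sumr; apply: ler_sum => l _ /=.
by rewrite normcM exprMn mulrCA.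
Qed.

(** Multiplication by a coordinate is bounded: the factorial quotient changes by (k+1)/(k+l+2) or
    (l+1)/(k+l+2), at most 1, and the power by at most 2^alpha, or 1 when alpha < 0. *)
Lemma ball_weight_step alpha : exists2 C : R, 0 <= C & forall k l,
  ball_weight alpha k.+1 l <= C * ball_weight alpha k l /\
  ball_weight alpha k l.+1 <= C * ball_weight alpha k l.
Proof.
have [C C0 hC] : exists2 C : R, 0 <= C & forall m,
    m.+3%:R `^ alpha <= C * m.+2%:R `^ alpha.
  have [a0|a0] := leP 0 alpha.
    exists (2 `^ alpha) => [|m]; first exact: powR_ge0.
    rewrite -powRM ?ler0n //; apply: ge0_ler_powR; rewrite ?nnegrE ?mulr_ge0 ?ler0n //.
    by rewrite -natrM ler_nat; lia.
  exists 1 => // m; rewrite mul1r -[alpha]opprK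
    !(powRN _ (- alpha)) lef_pV2 ?posrE ?powR_gt0 ?ltr0n //.
  by apply: ge0_ler_powR; rewrite ?nnegrE ?oppr_ge0 ?ler_nat // ltW.
exists C => // k l.
have f0 (n : nat) : 0 < (n`!)%:R :> R by rewrite ltr0n fact_gt0.
have key n : (n <= k + l)%N ->
    (n.+1%:R : R) / (k + l).+2%:R <= 1.
  by move=> nkl; rewrite ler_pdivrMr ?ltr0n // mul1r ler_nat; lia.
have main (n m1 m2 : nat) : (n <= k + l)%N -> (m1 = n.+1 * m2)%N ->
    (k + l).+3%:R `^ alpha * (m1%:R / ((k + l).+2`!)%:R) <=
    C * ((k + l).+2%:R `^ alpha * (m2%:R / ((k + l).+1`!)%:R)).
  move=> nkl ->; rewrite [leRHS]mulrA; apply: ler_pM.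
  - exact: powR_ge0.
  - by rewrite divr_ge0 ?ler0n.
  - exact: hC.
  rewrite [((k + l).+2)`!]factS (natrM _ n.+1) (natrM _ (k + l).+2) invfM mulrACA.
  apply: ler_piMl; last exact: key.
  by rewrite divr_ge0 ?ler0n.
rewrite /ball_weight !add2n !add1n ?addSn ?addnS; split.
  by apply: (main k); rewrite ?leq_addr // factS mulnA.
by apply: (main l); rewrite ?leq_addl // factS mulnCA.
Qed.

Lemma ball_weight_shift alpha i j : exists2 C : R, 0 <= C & forall k l,
  ball_weight alpha (i + k) (j + l) <= C * ball_weight alpha k l.
Proof.
have [C C0 hC] := ball_weight_step alpha.
exists (C ^+ i * C ^+ j) => [|k l]; first by rewrite mulr_ge0 ?exprn_ge0.
elim: i => [|i IH]; last first.
  rewrite addSn exprS -!mulrA; apply: le_trans (hC _ _).1 _.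
  by apply: ler_wpM2l; rewrite // mulrA.
elim: j => [|j IH]; first by rewrite !expr0 !mul1r.
rewrite addSn exprS expr0 mul1r -mulrA; apply: le_trans (hC _ _).2 _.
by apply: ler_wpM2l; rewrite // -[C ^+ j]mul1r.
Qed.

Lemma dl2le_shift2 alpha i j : exists2 C : R, 0 <= C & forall a B, dl2le alpha a B ->
  dl2le alpha (shift2 i j a) (C * B).
Proof.
have [C C0 hC] := ball_weight_shift alpha i j; exists C => // a B h N.
apply: le_trans (rect_sum_homo (ball_weight_sqr_ge0 alpha _) (leq_addl i N) (leq_addl j N)) _.
have -> : (fun k l => ball_weight alpha k l * normc (shift2 i j a k l) ^+ 2) =
    shift2 i j (fun k l => ball_weight alpha (i + k) (j + l) * normc (a k l) ^+ 2).
  apply/funext => k; apply/funext => l; rewrite /shift2.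
  case: ifP => [/andP[ik jl]|_]; last by rewrite normc0 expr0n mulr0.
  by rewrite !subnKC.
rewrite rect_sum_shift2; apply: le_trans (ler_wpM2l C0 (h N)).
rewrite mulr_sumr; apply: ler_sum => k _; rewrite mulr_sumr; apply: ler_sum => l _ /=.
by rewrite [leRHS]mulrA; apply: ler_wpM2r => //; apply: sqr_ge0.
Qed.

Lemma dl2le_tail alpha g B : dl2le alpha g B -> forall e, 0 < e -> exists N,
  dl2le alpha (fun k l => g k l - if (k < N)%N && (l < N)%N then g k l else 0) e.
Proof.
move=> hg e e0.
have w0 := ball_weight_sqr_ge0 alpha g.
have [N hN] := rect_sum_cauchy w0 hg e0; exists N => n.
pose P := maxn n N.
apply: le_trans (rect_sum_homo (ball_weight_sqr_ge0 alpha _) (leq_maxl n N) (leq_maxl n N)) _.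
apply: le_trans (ltW (hN P (leq_maxr n N))).
rewrite (rect_sum_widen _ (leq_maxr n N) (leq_maxr n N)) -sumrB.
apply: ler_sum => k _; rewrite -sumrB; apply: ler_sum => l _.
case: ifP => _; first by rewrite subrr normc0 expr0n mulr0 subrr.
by rewrite !subr0.
Qed.

End BallWeights.

(** * The closed invariant subspace generated by a function *)

Section Span.
Variable R : realType.
Implicit Types (F G H : R[i] * R[i] -> R[i]).

Lemma lin_spanD (S : set (R[i] * R[i] -> R[i])) G H : lin_span S G -> lin_span S H ->
  lin_span S (fun z => G z + H z).
Proof.
move=> [m [c [s [hs ->]]]] [n [c' [s' [hs' ->]]]].
exists (m + n)%N, (fun i => match fintype.split i with inl j => c j | inr j => c' j end),
  (fun i => match fintype.split i with inl j => s j | inr j => s' j end); split.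
  by move=> i; case: (fintype.split i).
apply/funext => z; rewrite big_split_ord /=; congr (_ + _); apply: eq_bigr => i _.
  by rewrite -[lshift n i]/(unsplit (inl i)) unsplitK.
by rewrite -[rshift m i]/(unsplit (inr i)) unsplitK.
Qed.

Lemma lin_spanZ (S : set (R[i] * R[i] -> R[i])) (c : R[i]) G : lin_span S G ->
  lin_span S (fun z => c * G z).
Proof.
move=> [m [d [s [hs ->]]]]; exists m, (fun i => c * d i), s; split => //.
by apply/funext => z; rewrite mulr_sumr; apply: eq_bigr => i _; rewrite mulrA.
Qed.

Lemma lin_span0 (S : set (R[i] * R[i] -> R[i])) : lin_span S (fun=> 0).
Proof.
exists 0%N, (fun=> 0), (fun=> fun=> 0); split; first by case.
by apply/funext => z; rewrite big_ord0.
Qed.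

Lemma lin_span_monomial F i j G : lin_span (monomial_multiples F) G ->
  lin_span (monomial_multiples F) (fun z => z.1 ^+ i * z.2 ^+ j * G z).
Proof.
move=> [m [c [s [hs ->]]]].
exists m, c, (fun n z => z.1 ^+ i * z.2 ^+ j * s n z); split.
  move=> n; have [k [l ->]] := hs n; exists (i + k)%N, (j + l)%N.
  by apply/funext => z; rewrite !exprD; ring.
apply/funext => z; rewrite mulr_sumr; apply: eq_bigr => n _; ring.
Qed.

Lemma lin_span_poly F (p : {poly R[i]}) :
  lin_span (monomial_multiples F) (fun z => p.[z.1] * F z).
Proof.
exists (size p), (fun i => p`_i), (fun i z => z.1 ^+ i * z.2 ^+ 0 * F z); split.
  by move=> i; exists i, 0%N.
apply/funext => z; rewrite horner_coef mulr_suml; apply: eq_bigr => i _.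
by rewrite expr0 mulr1 mulrA.
Qed.

(* [g] lies in the closed invariant subspace generated by [F], at the level of
   Taylor coefficients. *)
Definition approximable alpha F (g : nat -> nat -> R[i]) := forall e : R, 0 < e ->
  exists H h, [/\ lin_span (monomial_multiples F) H, taylor_on_ball h H &
    dl2le alpha (fun k l => g k l - h k l) e].

Variables (alpha : R) (F : R[i] * R[i] -> R[i]).
Implicit Types g : nat -> nat -> R[i].

Lemma approximableD g g' : approximable alpha F g -> approximable alpha F g' ->
  approximable alpha F (fun k l => g k l + g' k l).
Proof.
move=> hg hg' e e0; have e4 : 0 < e / 4 by lra.
have [H [h [H1 H2 H3]]] := hg _ e4; have [H' [h' [H1' H2' H3']]] := hg' _ e4.
exists (fun z => H z + H' z), (fun k l => h k l + h' k l); split.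
- exact: lin_spanD.
- exact: taylor_on_ballD.
have := dl2leD H3 H3'; have -> : 2 * (e / 4 + e / 4) = e by field.
congr (dl2le _ _ _); apply/funext => k; apply/funext => l; ring.
Qed.

Lemma approximableZ (c : R[i]) g : approximable alpha F g ->
  approximable alpha F (fun k l => c * g k l).
Proof.
move=> hg e e0; pose C := normc c ^+ 2 + 1.
have C0 : 0 < C by rewrite ltr_wpDl // sqr_ge0.
have [H [h [H1 H2 H3]]] := hg _ (divr_gt0 e0 C0).
exists (fun z => c * H z), (fun k l => c * h k l); split.
- exact: lin_spanZ.
- exact: taylor_on_ballZ.
have := dl2leZ c H3.
have -> : (fun k l => c * (g k l - h k l)) = (fun k l => c * g k l - c * h k l).
  by apply/funext => k; apply/funext => l; rewrite mulrBr.
apply: dl2le_le; rewrite mulrCA; apply: ler_piMr; first exact: ltW.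
by rewrite ler_pdivrMr // mul1r /C; lra.
Qed.

Lemma approximable_shift2 i j g : approximable alpha F g ->
  approximable alpha F (shift2 i j g).
Proof.
move=> hg e e0; have [C C0 hC] := dl2le_shift2 alpha i j.
have C1 : 0 < C + 1 by lra.
have [H [h [H1 H2 H3]]] := hg _ (divr_gt0 e0 C1).
exists (fun z => z.1 ^+ i * z.2 ^+ j * H z), (shift2 i j h); split.
- exact: lin_span_monomial.
- exact: taylor_on_ball_shift2.
have := hC _ _ H3.
have -> : shift2 i j (fun k l => g k l - h k l) =
    (fun k l => shift2 i j g k l - shift2 i j h k l).
  by apply/funext => k; apply/funext => l; rewrite /shift2; case: ifP; rewrite ?subr0.
apply: dl2le_le; rewrite mulrCA; apply: ler_piMr; first exact: ltW.
by rewrite ler_pdivrMr // mul1r; lra.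
Qed.

Lemma approximable0 : approximable alpha F (fun _ _ => 0).
Proof.
move=> e e0; exists (fun=> 0), (fun _ _ => 0); split; first exact: lin_span0.
  exact: taylor_on_ball_zero.
move=> N; rewrite /rect_sum big1 ?ltW // => k _; rewrite big1 // => l _.
by rewrite subr0 normc0 expr0n mulr0.
Qed.

Lemma approximable_sum n (g : nat -> nat -> nat -> R[i]) :
  (forall i, approximable alpha F (g i)) ->
  approximable alpha F (fun k l => \sum_(i < n) g i k l).
Proof.
move=> hg; elim: n => [|n IH].
  have -> : (fun k l => \sum_(i < 0) g i k l) = (fun _ _ => 0).
    by apply/funext => k; apply/funext => l; rewrite big_ord0.
  exact: approximable0.
have -> : (fun k l => \sum_(i < n.+1) g i k l) =
   (fun k l => \sum_(i < n) g i k l + g n k l).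
  by apply/funext => k; apply/funext => l; rewrite big_ord_recr.
exact: approximableD.
Qed.

Lemma approximable_lim g : (forall e, 0 < e -> exists g', approximable alpha F g' /\
    dl2le alpha (fun k l => g k l - g' k l) e) ->
  approximable alpha F g.
Proof.
move=> hg e e0; have e4 : 0 < e / 4 by lra.
have [g' [hg' d1]] := hg _ e4; have [H [h [H1 H2 d2]]] := hg' _ e4.
exists H, h; split => //; have := dl2leD d1 d2.
have -> : 2 * (e / 4 + e / 4) = e by field.
congr (dl2le _ _ _); apply/funext => k; apply/funext => l; ring.
Qed.

(** Once the constant 1 is approximable, so are its shifts, which are the monomials, hence
    polynomials, which are dense. *)
Lemma approximable_all g B : approximable alpha F (E1_coef (1 : fps R[i])) ->
  dl2le alpha g B -> approximable alpha F g.
Proof.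
move=> h1 hg; apply: approximable_lim => e e0.
have [N hN] := dl2le_tail hg e0.
exists (fun k l => if (k < N)%N && (l < N)%N then g k l else 0); split => //.
have -> : (fun k l => if (k < N)%N && (l < N)%N then g k l else 0) =
    (fun k l => \sum_(i < N) \sum_(j < N) g i j * shift2 i j (E1_coef (1 : fps R[i])) k l).
  apply/funext => k; apply/funext => l.
  have sE (i j : nat) : shift2 i j (E1_coef (1 : fps R[i])) k l = ((i == k) && (j == l))%:R.
    rewrite /shift2 /E1_coef fps1E !subn_eq0.
    case: (ltngtP i k) => //= ik; case: (ltngtP j l) => //= jl.
  case: ifP => [/andP[kN lN]|kl].
    rewrite (bigD1 (Ordinal kN)) //= (bigD1 (Ordinal lN)) //= sE !eqxx mulr1.
    rewrite big1 ?addr0 => [|j jl].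
      rewrite big1 ?addr0 // => i ik; rewrite big1 // => j _.
      by rewrite sE [(i : nat) == k](negPf ik) mulr0.
    by rewrite sE [(j : nat) == l](negPf jl) andbF mulr0.
  rewrite big1 // => i _; rewrite big1 // => j _; rewrite sE.
  case: eqP => [ik|_]; last by rewrite mulr0.
  case: eqP => [jl|_]; last by rewrite mulr0.
  by move: kl; rewrite -ik -jl !ltn_ord.
apply: (@approximable_sum N (fun i k l =>
  \sum_(j < N) g i j * shift2 i j (E1_coef (1 : fps R[i])) k l)) => i.
apply: (@approximable_sum N (fun j k l =>
  g i j * shift2 i j (E1_coef (1 : fps R[i])) k l)) => j.
exact/approximableZ/approximable_shift2.
Qed.

End Span.

(** * Data extracted from NZAC, cyclicity and the two-sided distance bound *)

Section Main.
Variable R : realType.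
Implicit Types (a h g : fps R[i]) (f : R[i] -> R[i]) (w : R[i]) (alpha : R).

Lemma sum_to_bounded a s : sum_to a s -> exists A : R, forall k, normc (a k) <= A.
Proof.
move=> /(_ 1 ltr01)[N hN]; exists (psum a N + 2) => k.
have [kN|Nk] := ltnP k N.
  apply: (@le_trans _ _ (psum a N)); last lra.
  rewrite /psum (bigD1 (Ordinal kN)) //= lerDl.
  by apply: sumr_ge0 => i _; apply: normc_ge0.
have := hN k Nk; have := hN k.+1 (leqW Nk); rewrite big_ord_recr /=.
set S := \sum_(i < k) a i => h1 h2.
have -> : a k = (S + a k - s) - (S - s) by ring.
apply: le_trans (le_normcB _ _) _; have := psum_ge0 a N; lra.
Qed.

(** The extra Euler terms feed [l2leM_euler]; for [g] one more is included, which the truncation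
    estimate of [one_variable_upper] consumes. *)
Lemma NZAC_factorization f : NZAC f -> exists a zs h g,
  [/\ [/\ l1 a, l1 (a + euler a) & forall z, normc z < 1 -> sum_to (dil z a) (f z)],
      [/\ all (fun w => normc w == 1) zs, exists w, w \in zs,
          a = fps_poly (unimodular_poly zs) * h & g * h = 1],
      l1 h /\ l1 (h + euler h) &
      [/\ l1 g, l1 (g + euler g) & l1 (g + euler g + euler (g + euler g))]].
Proof.
move=> [fn0 [r [F [r1 [a ha] Ff [zeta zeta1 Fz]]]]].
have hF z : normc z < r -> sum_to (dil z a) (F z) by move=> zr; apply/cvgcP/ha.
have haf z : normc z < 1 -> sum_to (dil z a) (f z).
  by move=> z1; rewrite -(Ff z z1); apply: hF; apply: lt_trans r1.
(* Convergence at the point q bounds the terms there, which is the class [geo q] with q still above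
   1. *)
pose q := (1 + r) / 2.
have q1 : 1 < q by rewrite /q; lra.
have qr : q < r by rewrite /q; lra.
have q0 : 0 < q by lra.
have nq : normc (q%:C : R[i]) = q by rewrite normc_real gtr0_norm.
have aq : geo q a.
  have nqr : normc (q%:C : R[i]) < r by rewrite nq.
  have [A hA] := sum_to_bounded (hF q%:C nqr).
  by exists A => k; have := hA k; rewrite normcM normcX nq.
have [la lea _] := geo_l1 q1 aq.
have at0 (d : fps R[i]) : sum_to (dil 0 d) (d 0%N).
  move=> e e0; exists 1%N => -[//|n] _; rewrite big_ord_recl big1 ?addr0.
    by rewrite /dil expr0 mulr1 subrr normc0.
  by move=> i _; rewrite /dil exprS mul0r mulr0.
have a0 : a 0%N != 0.
  have n0 : normc (0 : R[i]) < 1 by rewrite normc0 ltr01.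
  rewrite (sum_to_uniq (at0 a) (haf 0 n0)).
  exact: (fn0 0 n0).
have [zs [h [zs1 hq aE hcirc]]] := unimodular_factorization q1 aq a0.
have [lh leh le2h] := geo_l1 q1 hq.
have evQ z s : normc z <= 1 -> sum_to (dil z h) s ->
    sum_to (dil z a) ((unimodular_poly zs).[z] * s).
  move=> z1 hs; rewrite aE dilM; apply: sum_toM => //; last exact: sum_to_poly.
    exact/l1_dil/l1_poly.
  exact: l1_dil.
(* On the circle this is the outcome of the factorization; inside, a zero of [h] would be one of
   [f]. *)
have hn0 z : normc z <= 1 -> ~ sum_to (dil z h) 0.
  rewrite le_eqVlt => /orP[/eqP /hcirc //|z1] h0.
  have := evQ z 0 (ltW z1) h0; rewrite mulr0 => /(sum_to_uniq (haf z z1)) fz.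
  by have := fn0 z z1; rewrite fz eqxx.
have [m m0 hm] := modulus_lower_bound lh leh hn0.
have h00 : h 0%N != 0.
  apply/eqP => h0; have := at0 h; rewrite h0; apply: hn0.
  by rewrite normc0.
have [g gh] := fps_inv_exists h00.
have lg := l1_inverse gh lh leh le2h m0 hm.
have leg : l1 (euler g) by rewrite (euler_inv gh); apply/l1N/l1M/leh/l1X.
have le2g : l1 (euler (euler g)).
  rewrite (euler2_inv gh) mulr2n; apply: l1D; last by apply/l1N/l1M/le2h/l1X.
  by apply: l1D; apply/l1M/l1X/leh/l1X.
have zeta1' : normc zeta <= 1 by rewrite zeta1.
(* With no factor split off, [h] would be [a] and would vanish at [zeta]. *)
have [w wzs] : exists w, w \in zs.
  case: zs zs1 aE evQ => [|w zs _ _ _]; last by exists w; rewrite mem_head.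
  move=> _ aE _; exfalso; apply: (hn0 zeta zeta1').
  have := hF zeta; rewrite zeta1 Fz => /(_ r1).
  by rewrite aE /unimodular_poly big_nil fps_poly1 mul1r.
exists a, zs, h, g; split.
- by split => //; apply: l1D.
- by split => //; exists w.
- by split => //; apply: l1D.
split => //; first exact: l1D.
by rewrite eulerD; apply: l1D; apply: l1D.
Qed.

Lemma sum_to_mul_poly a f (p : {poly R[i]}) : l1 a ->
  (forall z, normc z < 1 -> sum_to (dil z a) (f z)) ->
  taylor_on_ball (E1_coef (fps_poly p * a)) (fun z => p.[z.1] * E1 f z).
Proof.
move=> la haf; apply: (@taylor_on_ball_E1 _ _ (fun z => p.[z] * f z)).
  exact/l1M/la/l1_poly.
move=> z z1; rewrite dilM; apply: sum_toM.
- exact/l1_dil/l1_poly/ltW.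
- exact/l1_dil/la/ltW.
- exact: sum_to_poly.
exact: haf.
Qed.

Lemma taylor_on_ball_one : taylor_on_ball (E1_coef (1 : fps R[i])) (fun=> 1).
Proof.
apply: (@taylor_on_ball_E1 _ _ (fun=> 1)); first exact: l1_one.
by move=> z _; apply: sum_to1.
Qed.

Lemma E1_coefB (c d : fps R[i]) :
  (fun k l => E1_coef c k l - E1_coef d k l) = E1_coef (c - d).
Proof.
apply/funext => k; apply/funext => l; rewrite /E1_coef; case: ifP => // _.
by rewrite subr0.
Qed.

Lemma l2le_opp (s : nat -> R) (d : fps R[i]) B : l2le s (- d) B -> l2le s d B.
Proof.
by move=> h N; have := h N; under eq_bigr => k _ do rewrite fpsNE normcN.
Qed.

Lemma inv_sqr_sum_unbounded (C : R) :
  exists n, C < inv_sqr_sum (pow_weight 1) n.+1.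
Proof.
apply: contrapT => hn; apply: (@dvg_harmonic R); apply: nondecreasing_is_cvgn.
  by apply/nondecreasing_seqP => n; rewrite seriesSr lerDl; apply: harmonic_ge0.
exists C => _ [n _ <-]; rewrite leNgt; apply/negP => Cn; apply: hn.
exists n; apply: lt_le_trans Cn _; rewrite seriesEord inv_sqr_sum_powE big_ord_recr /=.
apply: ler_wpDr; first by rewrite invr_ge0 powR_ge0.
by apply: ler_sum => k _; rewrite powRr1 ?ler0n.
Qed.

Lemma cyclic_E1 alpha f : alpha <= 2 -> NZAC f -> cyclic alpha (E1 f).
Proof.
move=> a2 /NZAC_factorization [a [zs [h [g [[la lea haf] [zs1 _ aE gh] [lh leh] [lg _ l2g]]]]]].
have t12 : 1 <= (2 : R) <= 2 by rewrite ler1n lexx.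
have b21 : 2 - 1 = 1 :> R by ring.
have b01 : 0 <= (1 : R) <= 1 by rewrite ler01 lexx.
have tE1 : taylor_on_ball (E1_coef a) (E1 f) by apply: taylor_on_ball_E1.
split; first split; first by exists (E1_coef a).
  apply/(sqnorm2_lty alpha tE1); have [A hA] := lea.
  exists (4 * (A ^+ 2 * 1)); apply: (dl2le_exponent a2); apply: dl2le_E1 => //.
  have W := pow_weightP b01.
  by rewrite b21 -[a]mulr1; apply: l2leM_euler (l2le_one W).
have one : approximable alpha (E1 f) (E1_coef (1 : fps R[i])).
  move=> e e0; have [C hC] := one_variable_upper (pow_weightP b01) zs1 aE gh leh l2g.
  (* The factor 4 is the weight comparison of [dl2le_E1]; the threshold brings 4 C / K below [e]. *)
  have [n hn] := inv_sqr_sum_unbounded (4 * C / e).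
  have [p _ hp] := hC n.
  exists (fun z => p.[z.1] * E1 f z), (E1_coef (fps_poly p * a)); split.
  - exact: lin_span_poly.
  - exact: sum_to_mul_poly.
  rewrite E1_coefB; apply: (dl2le_exponent a2).
  have K0 : 0 < inv_sqr_sum (pow_weight (1 : R)) n.+1.
    by apply: lt_le_trans ltr01 (inv_sqr_sum_ge1 (pow_weightP b01) _).
  apply: (dl2le_le _ (dl2le_E1 t12 _)); last by rewrite b21; apply: hp.
  by rewrite mulrA ler_pdivrMr // [leRHS]mulrC -ler_pdivrMr // ltW.
apply/seteqP; split => [G []//|G [[b tG] nG]].
split; first by split => //; exists b.
move=> e e0; have [B hB] := (sqnorm2_lty alpha tG).1 nG.
(* Halving turns the weak bound on the squared norm into the strict one required of the norm. *)
have e2 : 0 < (e / 2) ^+ 2 by rewrite exprn_gt0 // divr_gt0.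
have [H [c [H1 H2 H3]]] := approximable_all one hB e2.
exists H => //; rewrite /dnorm.
have := (sqnorm2_le alpha ((e / 2) ^+ 2) (taylor_on_ballB tG H2)).2 H3.
rewrite -lee_sqrt ?lee_fin ?(ltW e2) // => /le_lt_trans; apply.
rewrite /= lte_fin sqrtr_sqr gtr0_norm ?divr_gt0 //; lra.
Qed.

Lemma polys_horner n (p : {poly R[i]}) : (size p <= (2 * n).+1)%N ->
  polys n (fun z => p.[z.1]).
Proof.
move=> sp; exists (fun k l => if l == 0%N then p`_k else 0); apply/funext => z.
rewrite (horner_coef_wide _ sp); apply: eq_bigr => k _.
rewrite big_mkcond big_ord_recl /= addn0 -ltnS ltn_ord expr0 mulr1 big1 ?addr0 // => l _.
by case: ifP => // _; rewrite !mul0r.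
Qed.

(** Monomials with a positive power of z2 leave nothing in the column l = 0, so that column comes
    from the part of [P] free of z2. *)
Lemma polys_mul_coef n (P : R[i] * R[i] -> R[i]) a f : polys n P ->
    taylor_on_ball (E1_coef a) (E1 f) ->
  exists (p : {poly R[i]}) b, [/\ (size p <= (2 * n).+1)%N,
    taylor_on_ball b (fun z => P z * E1 f z - 1) &
    forall k, b k 0%N = (fps_poly p * a - 1) k].
Proof.
move=> [c ->] ta; pose m := (2 * n).+1.
pose b k l := \sum_(i < m) \sum_(j < m | (i + j <= 2 * n)%N)
  c i j * shift2 i j (E1_coef a) k l.
exists (\poly_(i < m) c i 0%N), (fun k l => b k l - E1_coef (1 : fps R[i]) k l); split.
- exact: size_poly.
- apply: taylor_on_ballB taylor_on_ball_one.
  have -> : (fun z => (\sum_(k < m) \sum_(l < m | (k + l <= 2 * n)%N)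
        c k l * z.1 ^+ k * z.2 ^+ l) * E1 f z) =
      (fun z => \sum_(i < m) \sum_(j < m | (i + j <= 2 * n)%N)
        c i j * (z.1 ^+ i * z.2 ^+ j * E1 f z)).
    apply/funext => z; rewrite mulr_suml; apply: eq_bigr => i _.
    by rewrite mulr_suml; apply: eq_bigr => j _; rewrite !mulrA.
  apply: (@taylor_on_ball_sum _ _ _ _ (fun (i : 'I_m) k l =>
    \sum_(j < m | (i + j <= 2 * n)%N) c i j * shift2 i j (E1_coef a) k l)) => i _.
  apply: (@taylor_on_ball_sum _ _ _ _ (fun (j : 'I_m) k l =>
    c i j * shift2 i j (E1_coef a) k l)) => j _.
  exact/taylor_on_ballZ/taylor_on_ball_shift2.
move=> k; rewrite fpsBE; congr (_ - _); rewrite fpsME /b.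
transitivity (\sum_(i < m) if (i <= k)%N then c i 0%N * a (k - i)%N else 0).
  apply: eq_bigr => i _; rewrite big_mkcond big_ord_recl /= addn0 -ltnS ltn_ord.
  rewrite [X in _ + X]big1 ?addr0 => [|j _].
    by rewrite /shift2 /E1_coef leq0n andbT sub0n eqxx; case: ifP => // _; rewrite mulr0.
  by case: ifP => // _; rewrite /shift2 andbF mulr0.
(* One side runs over i < m, the other over i <= k; [F] carries both cutoffs on a common range. *)
pose F i := (if (i < m)%N then c i 0%N else 0) * (if (i <= k)%N then a (k - i)%N else 0).
transitivity (\sum_(i < maxn m k.+1) F i).
  rewrite (big_ord_widen (maxn m k.+1)
    (fun i => if (i <= k)%N then c i 0%N * a (k - i)%N else 0)) ?leq_maxl //.
  rewrite big_mkcond; apply: eq_bigr => i _; rewrite /F.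
  by case: ifP; case: ifP; rewrite ?mul0r ?mulr0.
apply/esym; rewrite (big_ord_widen (maxn m k.+1)
  (fun i => fps_poly (\poly_(i < m) c i 0%N) i * a (k - i)%N)) ?leq_maxr //.
rewrite big_mkcond; apply: eq_bigr => i _; rewrite /F /fps_poly coef_poly ltnS.
by case: (leqP i k); rewrite ?mulr0.
Qed.

Lemma dist_one_bounds alpha f : 1 <= alpha <= 2 -> NZAC f ->
  exists c1 c2 : R, [/\ 0 < c1, 0 < c2 & forall n,
    ((c1 / inv_sqr_sum (pow_weight (alpha - 1)) n.+1)%:E
      <= dist_one alpha (E1 f) n ^+ 2
      <= (c2 / inv_sqr_sum (pow_weight (alpha - 1)) n.+1)%:E)%E].
Proof.
move=> a12 /NZAC_factorization [a [zs [h [g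
  [[la lea haf] [zs1 [w wzs] aE gh] [lh leh] [lg leg l2g]]]]]].
have b01 : 0 <= alpha - 1 <= 1 by lra.
have W := pow_weightP b01.
have [C hC] := one_variable_upper W zs1 aE gh leh l2g.
have [c c0 hc] := one_variable_lower W zs1 wzs aE gh lh lg leg.
have tE1 : taylor_on_ball (E1_coef a) (E1 f) by apply: taylor_on_ball_E1.
set K := inv_sqr_sum _.
have K0 n : 0 < K n.+1 by apply: lt_le_trans ltr01 (inv_sqr_sum_ge1 W _).
have C0 : 0 <= C.
  have [p _ /l2le_ge0] := hC 0%N; rewrite -/K pmulr_lge0 //.
  by rewrite invr_gt0.
(* The 4 comes from the weight comparison; adding 1 makes the constant positive even when C = 0. *)
exists c, (4 * C + 1); split => // [|n]; first by lra.
have x0 : 0 <= c / K n.+1 by rewrite divr_ge0 // ltW.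
have y0 : 0 <= (4 * C + 1) / K n.+1 by rewrite divr_ge0 ?ltW //; lra.
have low : (sqrte (c / K n.+1)%:E <= dist_one alpha (E1 f) n)%E.
  apply: le_ereal_inf_tmp => _ [P Pn <-].
  have [p [b [sp tb bE]]] := polys_mul_coef Pn tE1.
  rewrite /dnorm lee_sqrt ?sqnorm2_ge0 //.
  have := @sqnorm2_le _ alpha b _ (fine (sqnorm2 alpha (fun z => P z * E1 f z - 1))) tb.
  have := sqnorm2_ge0 alpha (fun z => P z * E1 f z - 1).
  (* A product of infinite norm satisfies the lower bound trivially; otherwise the column l = 0 is
     compared with one variable. *)
  case: (sqnorm2 _ _) => [B B0 [+ _]|_ _|//]; last exact: leey.
  rewrite lee_fin /= => /(_ (lexx _)) /(l2le_column a12 bE) hB.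
  apply: (hc n p B sp); apply: l2le_opp.
  by have -> : - (1 - fps_poly p * a) = fps_poly p * a - 1 by ring.
have up : (dist_one alpha (E1 f) n <= sqrte ((4 * C + 1) / K n.+1)%:E)%E.
  have [p sp hp] := hC n.
  apply: ge_ereal_inf; exists (dnorm alpha (fun z => p.[z.1] * E1 f z - 1)).
    by exists (fun z => p.[z.1]) => //; apply: polys_horner.
  have tb := taylor_on_ballB (sum_to_mul_poly p la haf) taylor_on_ball_one.
  rewrite /dnorm lee_sqrt ?lee_fin //; apply/(sqnorm2_le _ _ tb).
  rewrite E1_coefB; apply: (dl2le_le _ (dl2le_E1 a12 _)); last first.
    apply: l2le_opp.
    have -> : - (fps_poly p * a - 1) = 1 - fps_poly p * a by ring.
    exact: hp.
  rewrite mulrA; apply: ler_wpM2r; first by rewrite invr_ge0 ltW.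
  by lra.
have d0 : (0 <= dist_one alpha (E1 f) n)%E by apply: le_trans low; apply: sqrte_ge0.
apply/andP; split.
  by rewrite -(@sqr_sqrte _ (c / K n.+1)%:E) ?lee_fin // lee_sqr ?sqrte_ge0.
by rewrite -(@sqr_sqrte _ ((4 * C + 1) / K n.+1)%:E) ?lee_fin // lee_sqr ?sqrte_ge0.
Qed.

End Main.

Theorem theorem2p1 (R : realType) (alpha : R) (f : R[i] -> R[i])
    (halpha : alpha <= 2) (hf : dirichlet1 (alpha - 1) f) (hN : NZAC f) :
  cyclic alpha (E1 f) /\
  (1 <= alpha ->
   asymp (fun n : nat => (dist_one alpha (E1 f) n ^+ 2)%E)
         (fun n : nat => (varphi (alpha - 1) n.+1)^-1)).
Proof.
split=> [|a1]; first exact: cyclic_E1.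
have a12 : 1 <= alpha <= 2 by rewrite a1 halpha.
have b01 : 0 <= alpha - 1 <= 1 by lra.
have W := pow_weightP b01.
have [c1 [c2 [c10 c20 hc]]] := dist_one_bounds a12 hN.
have [c [c0 lo up]] := inv_sqr_sum_varphi b01.
have K0 n : 0 < inv_sqr_sum (pow_weight (alpha - 1)) n.+1.
  by apply: lt_le_trans ltr01 (inv_sqr_sum_ge1 W _).
have phi0 n : 0 < varphi (alpha - 1) n.+1.
  by rewrite -(pmulr_rgt0 _ c0); apply: lt_le_trans (up n).
(* The lower constant loses c through K <= c varphi; the upper one is kept since varphi <= K. *)
exists (c1 / c), c2; split => // [|n]; first exact: divr_gt0.
have /andP[h1 h2] := hc n; apply/andP; split.
  apply: le_trans h1; rewrite lee_fin -mulrA -invfM; apply: ler_wpM2l; first exact: ltW.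
  by rewrite lef_pV2 ?posrE ?mulr_gt0.
apply: le_trans h2 _; rewrite lee_fin; apply: ler_wpM2l; first exact: ltW.
by rewrite lef_pV2 ?posrE.
Qed.
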